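(* Let $T=(V,E)$ be a tree with $n$ nodes rooted at $v_1$, with leaf set $Y$ and a designated leaf $t_0$, and let $l\le w\le u$ be real edge vectors, $c>0$ an edge cost vector, and $D\in\mathbb{R}$. The problem (RIOVSPT$_{BH}$) can be solved in $O(n\log n)$ time; that is, there is an algorithm (Algorithm 1: binary search over the sorted distinct edge costs, testing feasibility of each candidate cost, followed by construction of a solution) that in $O(n\log n)$ time either correctly reports that the problem is infeasible or outputs an optimal solution $\tilde w$ together with its objective value $C(\tilde w)$.
   Context: For each leaf $t_k$, $P_k$ is the edge set of the path from $v_1$ to $t_k$; for $f:E\to\mathbb{R}$ and $S\subseteq E$, $f(S):=\sum_{e\in S}f(e)$. $H(a,b)=1$ if $a\neq b$ and $0$ otherwise. The problem (RIOVSPT$_{BH}$) is: minimize $C(\tilde w):=\max_{e\in E}c(e)H(\tilde w(e),w(e))$ over $\tilde w:E\to\mathbb{R}$ subject to $\tilde w(P_k)\ge D$ for all leaves $t_k$, $\tilde w(P_0)=D$, and $l(e)\le\tilde w(e)\le u(e)$ for all $e\in E$. *)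

(* Defs.v *)
From HB Require Import structures.
From mathcomp Require Import all_boot all_order all_algebra.
From mathcomp Require Import reals.
Set Implicit Arguments. Unset Strict Implicit. Unset Printing Implicit Defensive.
Import Order.TTheory GRing.Theory Num.Theory.
Local Open Scope ring_scope.

(** * Rooted trees

A tree with [n = m.+1] nodes has node set ['I_m.+1], rooted at [ord0], and edge
set ['I_m]: the edge [e] joins the non-root node [child e] to its parent
[par e].  The numbering of the nodes is arbitrary; in particular a node may
have a smaller number than its parent. *)

Definition child (m : nat) (e : 'I_m) : 'I_m.+1 := lift ord0 e.

Definition parent (m : nat) (par : 'I_m -> 'I_m.+1) (v : 'I_m.+1) : 'I_m.+1 :=
  if unlift ord0 v is Some e then par e else ord0.

Definition rooted_tree (m : nat) (par : 'I_m -> 'I_m.+1) : Prop :=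
  forall v, exists k, iter k (parent par) v = ord0.

Definition leaf (m : nat) (par : 'I_m -> 'I_m.+1) (v : 'I_m.+1) : Prop :=
  forall e, par e <> v.

(* The nodes of the path between [v] and the root are the iterates of [parent]
   on [v]; its edges are those joining such a node to its parent. *)
Definition root_path (m : nat) (par : 'I_m -> 'I_m.+1) (v : 'I_m.+1) :
    {set 'I_m} :=
  [set e | fconnect (parent par) v (child e)].

(** * The optimization problem *)

Definition weight (R : realType) (m : nat) (f : 'I_m -> R) (S : {set 'I_m}) : R :=
  \sum_(e in S) f e.

Definition hamming (R : realType) (a b : R) : R := if a != b then 1 else 0.

(* The terms are nonnegative when [0 < c], so the default value 0 of the
   maximum matters only for the tree without edges. *)
Definition objective (R : realType) (m : nat) (c w wt : 'I_m -> R) : R :=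
  \big[Num.max/0]_(e < m) (c e * hamming (wt e) (w e)).

Definition feasible (R : realType) (m : nat) (par : 'I_m -> 'I_m.+1)
    (t0 : 'I_m.+1) (l u : 'I_m -> R) (D : R) (wt : 'I_m -> R) : Prop :=
  [/\ forall t, leaf par t -> D <= weight wt (root_path par t),
      weight wt (root_path par t0) = D
    & forall e, l e <= wt e <= u e].

Definition optimal (R : realType) (m : nat) (par : 'I_m -> 'I_m.+1)
    (t0 : 'I_m.+1) (l w u c : 'I_m -> R) (D : R) (wt : 'I_m -> R) : Prop :=
  feasible par t0 l u D wt /\
  forall wt', feasible par t0 l u D wt' -> objective c w wt <= objective c w wt'.

(** * Real RAM

Programs act on finitely many (those named in the program text) integer
registers, real registers, integer arrays and real arrays, with indirect
addressing.  Every operation costs one time unit.  As usual for unit-cost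
models, integers have no multiplication and reals no rounding to integers; the
only constants are natural numbers, so no real number is hard-wired. *)

Inductive iexp : Type :=
  | ICst of nat
  | IReg of nat
  | IGet of nat & iexp         (* array, index *)
  | IAdd of iexp & iexp
  | ISub of iexp & iexp        (* truncated at 0 *)
  | IHalf of iexp.

Inductive rexp : Type :=
  | RCst of nat
  | RReg of nat
  | RGet of nat & iexp
  | RAdd of rexp & rexp
  | RSub of rexp & rexp
  | RMul of rexp & rexp
  | RDiv of rexp & rexp.       (* x / 0 = 0 *)

Inductive bexp : Type :=
  | ILe of iexp & iexp
  | RLe of rexp & rexp
  | BNot of bexp
  | BAnd of bexp & bexp.

Inductive cmd : Type :=
  | Skip
  | ISet of nat & iexp
  | RSet of nat & rexp
  | IPut of nat & iexp & iexp  (* array, index, value *)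
  | RPut of nat & iexp & rexp
  | Seq of cmd & cmd
  | If of bexp & cmd & cmd
  | While of bexp & cmd.

Record state (R : realType) : Type := State {
  ireg : nat -> nat;
  rreg : nat -> R;
  iarr : nat -> nat -> nat;
  rarr : nat -> nat -> R }.

Definition upd (T : Type) (f : nat -> T) (i : nat) (x : T) : nat -> T :=
  fun j => if j == i then x else f j.

Definition set_ireg (R : realType) (s : state R) (x k : nat) : state R :=
  State (upd (ireg s) x k) (rreg s) (iarr s) (rarr s).
Definition set_rreg (R : realType) (s : state R) (x : nat) (r : R) : state R :=
  State (ireg s) (upd (rreg s) x r) (iarr s) (rarr s).
Definition set_iarr (R : realType) (s : state R) (a i k : nat) : state R :=
  State (ireg s) (rreg s) (upd (iarr s) a (upd (iarr s a) i k)) (rarr s).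
Definition set_rarr (R : realType) (s : state R) (a i : nat) (r : R) : state R :=
  State (ireg s) (rreg s) (iarr s) (upd (rarr s) a (upd (rarr s a) i r)).

Fixpoint ieval (R : realType) (s : state R) (e : iexp) : nat :=
  match e with
  | ICst k => k
  | IReg x => ireg s x
  | IGet a e1 => iarr s a (ieval s e1)
  | IAdd e1 e2 => (ieval s e1 + ieval s e2)%N
  | ISub e1 e2 => (ieval s e1 - ieval s e2)%N
  | IHalf e1 => (ieval s e1)./2
  end.

Fixpoint reval (R : realType) (s : state R) (e : rexp) : R :=
  match e with
  | RCst k => k%:R
  | RReg x => rreg s x
  | RGet a e1 => rarr s a (ieval s e1)
  | RAdd e1 e2 => reval s e1 + reval s e2
  | RSub e1 e2 => reval s e1 - reval s e2
  | RMul e1 e2 => reval s e1 * reval s e2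
  | RDiv e1 e2 => reval s e1 / reval s e2
  end.

Fixpoint beval (R : realType) (s : state R) (b : bexp) : bool :=
  match b with
  | ILe e1 e2 => (ieval s e1 <= ieval s e2)%N
  | RLe e1 e2 => reval s e1 <= reval s e2
  | BNot b1 => ~~ beval s b1
  | BAnd b1 b2 => beval s b1 && beval s b2
  end.

Fixpoint icost (e : iexp) : nat :=
  match e with
  | ICst _ | IReg _ => 1
  | IGet _ e1 | IHalf e1 => (icost e1).+1
  | IAdd e1 e2 | ISub e1 e2 => (icost e1 + icost e2).+1
  end.

Fixpoint rcost (e : rexp) : nat :=
  match e with
  | RCst _ | RReg _ => 1
  | RGet _ e1 => (icost e1).+1
  | RAdd e1 e2 | RSub e1 e2 | RMul e1 e2 | RDiv e1 e2 => (rcost e1 + rcost e2).+1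
  end.

Fixpoint bcost (b : bexp) : nat :=
  match b with
  | ILe e1 e2 => (icost e1 + icost e2).+1
  | RLe e1 e2 => (rcost e1 + rcost e2).+1
  | BNot b1 => (bcost b1).+1
  | BAnd b1 b2 => (bcost b1 + bcost b2).+1
  end.

(* [exec p s t s']: started in [s], the program [p] halts in [s'] after exactly
   [t] time units. *)
Inductive exec (R : realType) : cmd -> state R -> nat -> state R -> Prop :=
  | ExSkip s : exec Skip s 1 s
  | ExISet s x e : exec (ISet x e) s (icost e).+1 (set_ireg s x (ieval s e))
  | ExRSet s x e : exec (RSet x e) s (rcost e).+1 (set_rreg s x (reval s e))
  | ExIPut s a i e :
      exec (IPut a i e) s (icost i + icost e).+1
        (set_iarr s a (ieval s i) (ieval s e))
  | ExRPut s a i e :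
      exec (RPut a i e) s (icost i + rcost e).+1
        (set_rarr s a (ieval s i) (reval s e))
  | ExSeq s1 s2 s3 p q t1 t2 :
      exec p s1 t1 s2 -> exec q s2 t2 s3 -> exec (Seq p q) s1 (t1 + t2)%N s3
  | ExIfT s s' b p q t :
      beval s b -> exec p s t s' -> exec (If b p q) s (bcost b + t).+1 s'
  | ExIfF s s' b p q t :
      ~~ beval s b -> exec q s t s' -> exec (If b p q) s (bcost b + t).+1 s'
  | ExWhileF s b p : ~~ beval s b -> exec (While b p) s (bcost b).+1 s
  | ExWhileT s1 s2 s3 b p t1 t2 :
      beval s1 b -> exec p s1 t1 s2 -> exec (While b p) s2 t2 s3 ->
      exec (While b p) s1 (bcost b + t1 + t2).+1 s3.

(** * Input and output *)

(* An array of data about edges: the entry of [e] is in the cell whose index is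
   the number of the node [child e]. *)
Definition edge_array (T : Type) (x0 : T) (m : nat) (f : 'I_m -> T) : nat -> T :=
  fun i => if i is j.+1 then oapp f x0 (insub j) else x0.

(* Integer registers 0, 1: the number of nodes and the designated leaf; real
   register 0: [D]; integer array 0: the parents; real arrays 0 to 3: [l], [w],
   [u], [c].  The rest of the memory is 0. *)
Definition input (R : realType) (m : nat) (par : 'I_m -> 'I_m.+1)
    (t0 : 'I_m.+1) (l w u c : 'I_m -> R) (D : R) : state R :=
  State (nth 0%N [:: m.+1; nat_of_ord t0])
        (nth 0 [:: D])
        (nth (fun=> 0%N) [:: edge_array 0%N (fun e => nat_of_ord (par e))])
        (nth (fun=> 0) [:: edge_array 0 l; edge_array 0 w;
                           edge_array 0 u; edge_array 0 c]).

(* Integer register 0: 0 for an infeasible instance, 1 otherwise; in the latter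
   case real array 4 is the solution and real register 0 its objective value. *)
Definition correct_output (R : realType) (m : nat) (par : 'I_m -> 'I_m.+1)
    (t0 : 'I_m.+1) (l w u c : 'I_m -> R) (D : R) (s : state R) : Prop :=
  let wt (e : 'I_m) := rarr s 4 (child e) in
  (ireg s 0 = 0%N /\ ~ (exists wt', feasible par t0 l u D wt')) \/
  [/\ ireg s 0 = 1%N, optimal par t0 l w u c D wt & rreg s 0 = objective c w wt].

(* [trunc_log 2 n] is the integer part of the binary logarithm, at least half
   of it for [n >= 2], so the rounding does not affect the class O(n log n). *)
Definition O_nlogn (T : nat -> nat) : Prop :=
  exists K N : nat, forall n, (N <= n)%N -> (T n <= K * (n * trunc_log 2 n))%N.

(* Main.v *)
Require Import Defs.
From mathcomp Require Import all_boot all_order all_algebra.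
From mathcomp Require Import boolp reals zify lra.
Import Order.TTheory GRing.Theory Num.Theory.

Set Implicit Arguments. Unset Strict Implicit. Unset Printing Implicit Defensive.

(* A solution of objective value at most C exists iff the edges of cost at most C
   can be changed within their bounds so as to satisfy the constraints.  Let H and
   L be the largest and smallest distances from the root allowed by C.  Any such
   solution has distances at most min (H v) (L v + D - L t0) at the nodes v of the
   path to t0, and at most those of its parent plus the upper bound of the edge
   elsewhere; if L t0 <= D <= H t0, the weights with exactly these distances are
   within the bounds, since the increments of a minimum of two functions lie
   between theirs.  So one linear pass over the nodes by increasing depth decides
   whether C is attainable.  The least attainable C is 0 or an edge cost, and is
   found by binary search in the sorted costs.  The depths, by which the nodes are
   sorted, are computed by pointer doubling. *)

(** * Reasoning about programs *)

Arguments upd T f i x j /.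

(** The first component of a pair is the kind of memory: 0 and 1 for integer and real registers, 2
    and 3 for integer and real arrays. The list is syntactic, so frame conditions for concrete
    programs are settled by computation. *)
Fixpoint writes (p : cmd) : seq (nat * nat) :=
  match p with
  | Skip => [::]
  | ISet x _ => [:: (0, x)]
  | RSet x _ => [:: (1, x)]
  | IPut a _ _ => [:: (2, a)]
  | RPut a _ _ => [:: (3, a)]
  | Seq p q | If _ p q => writes p ++ writes q
  | While _ p => writes p
  end.

Section ProgramLogic.
Variable R : realType.
Implicit Types (s : state R) (p q : cmd) (Q : state R -> Prop).

Definition agree (W : seq (nat * nat)) s s' : Prop :=
  [/\ forall x, (0, x) \notin W -> ireg s' x = ireg s x,
      forall x, (1, x) \notin W -> rreg s' x = rreg s x,
      forall a, (2, a) \notin W -> iarr s' a = iarr s a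
    & forall a, (3, a) \notin W -> rarr s' a = rarr s a].

Lemma agree_refl W s : agree W s s. Proof. by split. Qed.

Lemma agree_sub W W' s s' : {subset W <= W'} -> agree W s s' -> agree W' s s'.
Proof.
by move=> sub [h0 h1 h2 h3]; split=> x nx; [apply: h0|apply: h1|apply: h2|apply: h3];
  apply: contra nx => /sub.
Qed.

Lemma agree_trans W s1 s2 s3 : agree W s1 s2 -> agree W s2 s3 -> agree W s1 s3.
Proof.
move=> [a0 a1 a2 a3] [b0 b1 b2 b3].
by split=> x nx; [rewrite b0 ?a0|rewrite b1 ?a1|rewrite b2 ?a2|rewrite b3 ?a3].
Qed.

Lemma exec_agree p s t s' : exec p s t s' -> agree (writes p) s s'.
Proof.
have catl (A B : seq (nat * nat)) : {subset A <= A ++ B} by move=> x; rewrite mem_cat => ->.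
have catr (A B : seq (nat * nat)) : {subset B <= A ++ B} by move=> x; rewrite mem_cat orbC => ->.
elim=> {p s t s'} /=; try by move=> *; exact: agree_refl.
- by move=> s x e; split=> //= y; rewrite inE xpair_eqE /= => /negPf ->.
- by move=> s x e; split=> //= y; rewrite inE xpair_eqE /= => /negPf ->.
- by move=> s a i e; split=> //= y; rewrite inE xpair_eqE /= => /negPf ->.
- by move=> s a i e; split=> //= y; rewrite inE xpair_eqE /= => /negPf ->.
- move=> s1 s2 s3 p q t1 t2 _ h1 _ h2.
  by apply: (agree_trans (agree_sub (catl _ _) h1) (agree_sub (catr _ _) h2)).
- by move=> s s' b p q t _ _; apply: agree_sub; exact: catl.
- by move=> s s' b p q t _ _; apply: agree_sub; exact: catr.
- by move=> s1 s2 s3 b p t1 t2 _ _ h1 _ h2; apply: agree_trans h1 h2.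
Qed.

Definition runs p s (B : nat) Q : Prop :=
  exists t s', [/\ exec p s t s', t <= B & Q s'].

(** The frame [agree] is supplied when a postcondition is weakened, so specifications speak only of
    the memory that a program changes. *)
Lemma runs_weaken p s B B' Q Q' :
  runs p s B Q -> B <= B' ->
  (forall s', agree (writes p) s s' -> Q s' -> Q' s') -> runs p s B' Q'.
Proof.
move=> [t [s' [ex tB Qs]]] BB QQ; exists t, s'; split=> //.
  exact: leq_trans tB BB.
exact: QQ (exec_agree ex) Qs.
Qed.

Lemma runs_seq B1 p q s B Q :
  B1 <= B -> runs p s B1 (fun s1 => runs q s1 (B - B1) Q) -> runs (Seq p q) s B Q.
Proof.
move=> le_B [t [s1 [ex tB [t' [s2 [ex' tB' Qs]]]]]].
exists (t + t'), s2; split=> //; first exact: ExSeq ex ex'.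
by move: tB tB' le_B; lia.
Qed.

(** Charges both branches of a conditional. It bounds the running time of loop-free programs only;
    [wpl] is false on loops. *)
Fixpoint ccost p : nat :=
  match p with
  | Skip => 1
  | ISet _ e => (icost e).+1
  | RSet _ e => (rcost e).+1
  | IPut _ i e => (icost i + icost e).+1
  | RPut _ i e => (icost i + rcost e).+1
  | Seq p q => ccost p + ccost q
  | If b p q => (bcost b + (ccost p + ccost q)).+1
  | While _ _ => 0
  end.

Fixpoint wpl p s Q : Prop :=
  match p with
  | Skip => Q s
  | ISet x e => Q (set_ireg s x (ieval s e))
  | RSet x e => Q (set_rreg s x (reval s e))
  | IPut a i e => Q (set_iarr s a (ieval s i) (ieval s e))
  | RPut a i e => Q (set_rarr s a (ieval s i) (reval s e))
  | Seq p q => wpl p s (fun s' => wpl q s' Q)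
  | If b p q => (beval s b -> wpl p s Q) /\ (~~ beval s b -> wpl q s Q)
  | While _ _ => False
  end.

Lemma runs_wpl p s Q : wpl p s Q -> runs p s (ccost p) Q.
Proof.
elim: p s Q => /=.
- by move=> s Q Qs; exists 1, s; split=> //; apply: ExSkip.
- by move=> x e s Q Qs; eexists _, _; split; [apply: ExISet| |].
- by move=> x e s Q Qs; eexists _, _; split; [apply: ExRSet| |].
- by move=> x i e s Q Qs; eexists _, _; split; [apply: ExIPut| |].
- by move=> x i e s Q Qs; eexists _, _; split; [apply: ExRPut| |].
- move=> p IHp q IHq s Q h; apply: (runs_seq (leq_addr _ _)).
  by rewrite addKn; apply: (runs_weaken (IHp _ _ h)) => // s' _ h'; apply: IHq.
- move=> b p IHp q IHq s Q [hT hF]; case: (boolP (beval s b)) => bs.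
    have [t [s' [ex tB Qs]]] := IHp _ _ (hT bs).
    exists (bcost b + t).+1, s'; split=> //; first exact: ExIfT ex.
    by move: tB; lia.
  have [t [s' [ex tB Qs]]] := IHq _ _ (hF bs).
  exists (bcost b + t).+1, s'; split=> //; first exact: ExIfF ex.
  by move: tB; lia.
- by [].
Qed.

Lemma runs_loopfree p s B Q : ccost p <= B -> wpl p s Q -> runs p s B Q.
Proof. by move=> le_B h; apply: (runs_weaken (runs_wpl h)). Qed.

Lemma runs_seq_wpl p q s B Q :
  ccost p <= B -> wpl p s (fun s1 => runs q s1 (B - ccost p) Q) ->
  runs (Seq p q) s B Q.
Proof. by move=> le_B /runs_wpl; apply: runs_seq. Qed.

(* The counter [k] of the invariant bounds the number of remaining rounds. *)
Lemma runs_while (I : nat -> state R -> Prop) b p B s0 k0 :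
  (forall k s, agree (writes p) s0 s -> I k s -> beval s b ->
     exists2 k', k' < k & runs p s B (fun s' => I k' s')) ->
  I k0 s0 ->
  runs (While b p) s0 (k0 * (bcost b + B).+1 + (bcost b).+1)
    (fun s' => ~~ beval s' b /\ exists k, I k s').
Proof.
move=> step I0; have := agree_refl (writes p) s0; move: I0.
have gen k s : I k s -> agree (writes p) s0 s ->
    runs (While b p) s (k * (bcost b + B).+1 + (bcost b).+1)
      (fun s' => ~~ beval s' b /\ exists k, I k s').
  elim/ltn_ind: k s => k IH s Is ag; case: (boolP (beval s b)) => bs.
    have [k' lt_k' [t [s' [ex tB Is']]]] := step _ _ ag Is bs.
    have [t' [s'' [ex' tB' Qs]]] := IH _ lt_k' _ Is' (agree_trans ag (exec_agree ex)).
    exists (bcost b + t + t').+1, s''; split=> //; first exact: ExWhileT ex'.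
    have: k'.+1 * (bcost b + B).+1 <= k * (bcost b + B).+1 by rewrite leq_mul2r lt_k' orbT.
    rewrite mulSn; move: tB tB'; lia.
  exists (bcost b).+1, s; split; [exact: ExWhileF|lia|split=> //].
  by exists k.
exact: gen.
Qed.

(** The bound is reread from integer register 0, which holds the number of nodes until the final
    report. *)
Definition For x p : cmd :=
  Seq (ISet x (ICst 0))
      (While (BNot (ILe (IReg 0) (IReg x)))
             (Seq p (ISet x (IAdd (IReg x) (ICst 1))))).

Lemma runs_for (I : nat -> state R -> Prop) x p B n s :
  ireg s 0 = n -> 0 < x -> (0, x) \notin writes p -> (0, 0) \notin writes p ->
  0 < n ->
  I 0 (set_ireg s x 0) ->
  (forall i s1, i < n -> agree (writes (For x p)) s s1 -> ireg s1 x = i ->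
     I i s1 -> runs p s1 B (fun s2 => I i.+1 (set_ireg s2 x i.+1))) ->
  runs (For x p) s (n * (B + 16)) (fun s' => I n s').
Proof.
move=> s0 x0 xp zp n0 I0 step.
have xneq0 : (0 == x) = false by lia.
(* [k] counts the remaining rounds. *)
pose J k s1 := exists i, [/\ i + k = n, ireg s1 x = i & I i s1].
have agx s1 : agree (writes (Seq p (ISet x (IAdd (IReg x) (ICst 1)))))
    (set_ireg s x 0) s1 -> agree (writes (For x p)) s s1.
  move=> ag; apply: (@agree_trans _ _ (set_ireg s x 0)).
    by split=> //= y; rewrite inE negb_or xpair_eqE /= => /andP[/negPf ->].
  by apply: agree_sub ag => y /=; rewrite inE orbC => ->.
have ag0 s1 : agree (writes (For x p)) s s1 -> ireg s1 0 = n.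
  move=> [h _ _ _]; rewrite h //= inE mem_cat !inE !xpair_eqE /= xneq0 orbF.
  exact: zp.
have W : runs (While (BNot (ILe (IReg 0) (IReg x)))
             (Seq p (ISet x (IAdd (IReg x) (ICst 1))))) (set_ireg s x 0)
    (n * (4 + (B + 4)).+1 + 5)
    (fun s' => ~~ beval s' (BNot (ILe (IReg 0) (IReg x))) /\ exists k, J k s').
  apply: runs_while; last by exists 0; split=> //=; rewrite eqxx.
  move=> k s1 /agx ag [i [ik xi Ii]] /=; rewrite xi (ag0 _ ag) -ltnNge => lt_in.
  exists k.-1; first by lia.
  apply: (runs_seq (leq_addr _ _)); rewrite addKn.
  apply: (runs_weaken (step _ _ lt_in ag xi Ii)) => // s2 ag2 I2.
  apply: (@runs_weaken _ _ 4 _ (fun s' => J k.-1 s')) => //.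
  apply: runs_wpl => /=.
  have -> : ireg s2 x = i by case: ag2 => ->.
  exists i.+1; split; [lia|by rewrite /= eqxx addn1|by rewrite addn1].
have [t [s' [ex tB [bs [k [i [ik xi Ii]]]]]]] := W.
exists (2 + t), s'; split.
- by apply: ExSeq ex; apply: (@ExISet R s x (ICst 0)).
- by move: tB; lia.
- have := ag0 _ (agx _ (exec_agree ex)).
  move: bs; rewrite /= negbK xi => le_ni s'0.
  by have <- : i = n by lia.
Qed.

End ProgramLogic.

(** * Merge sort *)

Section MergeInvariant.
Variables (R : realType) (n : nat) (key : nat -> R) (w : nat) (A : nat -> nat).

(** The cut-off [len] lets this describe both a complete input array and an output array of which
    only the first entries are written. *)
Definition blocks_sorted (v len : nat) (f : nat -> nat) : Prop :=
  forall q x y, q * v <= x -> x <= y -> y < q * v + v -> y < len ->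
    (key (f x) <= key (f y))%R.

(** [k] is the output position, [i] and [j] are the read positions in the blocks ending at [mid] and
    [hi], which form pair number [q]; [q'] numbers the next pair. Output of the current pair is at
    most the next unread entry of either block, and all entries read so far occur in the output. *)
Definition merge_inv (k i j mid hi : nat) (B : nat -> nat) : Prop :=
  exists q q',
  [/\ [/\ q * (w + w) <= i <= mid, mid <= j <= hi, hi <= n, k + mid = i + j
        & hi <= q * (w + w) + (w + w) /\ (hi < n -> hi = q' * (w + w))],
      (forall x y, q * (w + w) <= x -> x <= y -> y < mid ->
         (key (A x) <= key (A y))%R) /\
      (forall x y, mid <= x -> x <= y -> y < hi -> (key (A x) <= key (A y))%R),
      blocks_sorted (w + w) k B,
      (forall x, q * (w + w) <= x < k ->
         (i < mid -> (key (B x) <= key (A i))%R) /\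
         (j < hi -> (key (B x) <= key (A j))%R))
    & (forall x, (x < i) || (mid <= x < j) -> exists2 y, y < k & B y = A x) /\
      (forall y, y < k -> B y < n)].

Hypothesis Alt : forall x, x < n -> A x < n.

(** Two empty blocks count as exhausted, so the first step opens the first real pair. *)
Lemma merge_inv0 B : merge_inv 0 0 0 0 0 B.
Proof.
by exists 0, 0; split=> //; split=> // x; rewrite ?ltn0 ?andbF.
Qed.

(** Once [hi <= k], the pair is completely written and [k = hi]; as [k < n], this is the start of
    pair [q']. *)
Lemma merge_inv_block k i j mid hi B :
  0 < w -> blocks_sorted w n A ->
  merge_inv k i j mid hi B -> hi <= k < n ->
  let mid' := minn (k + w) n in
  merge_inv k k mid' mid' (minn (mid' + w) n) B.
Proof.
move=> w0 Asort [q [q' [[h1 h2 h3 h4 [h5 h6]] _ Bs _ [cont Br]]]] hk mid'.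
have {h6} hq : k = q' * (w + w) by rewrite -h6; lia.
(* Pair [q'] consists of the blocks [2 * q'] and [2 * q' + 1] of width [w]. *)
have hqw : q' * (w + w) = (q' * 2) * w by lia.
have hqw' : q' * (w + w) + w = (q' * 2 + 1) * w by lia.
exists q', q'.+1; split.
- by rewrite /mid'; split; try lia; rewrite mulSn; lia.
- split=> x y h7 h8 h9.
    by apply: (Asort (q' * 2)) => //; move: h7 h8 h9; rewrite /mid' -?hqw; lia.
  apply: (Asort (q' * 2 + 1)) => //; move: h7 h8 h9; rewrite /mid' -?hqw'; lia.
- by [].
- by move=> x; lia.
- split=> // x hx; apply: cont; move: hx; rewrite /mid'; lia.
Qed.

(** Only the block containing [k] is affected, and its number must be [q], since any other block of
    that width misses [k]. *)
Lemma blocks_sorted_push k q B z :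
  q * (w + w) <= k < q * (w + w) + (w + w) ->
  blocks_sorted (w + w) k B ->
  (forall x, q * (w + w) <= x < k -> (key (B x) <= key z)%R) ->
  blocks_sorted (w + w) k.+1 (upd B k z).
Proof.
move=> hk Bs Bz r x y h1 h2 h3 h4; rewrite /upd.
have [yk|ny] := eqVneq y k; last first.
  rewrite ifF; last by lia.
  by apply: (Bs r) => //; lia.
have [_|nx] := eqVneq x k; first by rewrite lexx.
apply: Bz; suff : r = q by move=> <-; lia.
have [lt|gt|//] := ltngtP r q.
  have : r.+1 * (w + w) <= q * (w + w) by rewrite leq_mul2r lt orbT.
  rewrite mulSn; lia.
have : q.+1 * (w + w) <= r * (w + w) by rewrite leq_mul2r gt orbT.
rewrite mulSn; lia.
Qed.

(** Sortedness of the blocks and the comparison of their heads put [A i] below every unread entry,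
    so the bound on the output persists. *)
Lemma merge_inv_left k i j mid hi B :
  merge_inv k i j mid hi B -> i < mid ->
  (j < hi -> (key (A i) <= key (A j))%R) ->
  merge_inv k.+1 i.+1 j mid hi (upd B k (A i)).
Proof.
move=> [q [q' [[h1 h2 h3 h4 [h5 h6]] [As1 As2] Bs Bo [cont Br]]]] im Aij.
exists q, q'; split=> //.
- by split=> //; lia.
- apply: (@blocks_sorted_push _ q) => //; first by lia.
  by move=> x /Bo [h _]; apply: h.
- move=> x hx; rewrite /upd; case: eqVneq => [_|nx].
    by split=> // h; apply: As1 => //; lia.
  have {}/Bo[hi1 hi2] : q * (w + w) <= x < k by lia.
  split=> // h; apply: le_trans (hi1 im) _; apply: As1; lia.
- split=> [x hx|y hy]; rewrite /upd.
    have [->|nx] := eqVneq x i; first by exists k; rewrite ?eqxx.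
    have [|y hy <-] := cont x; first by lia.
    by exists y; [lia|rewrite ifF //; lia].
  case: eqVneq => [_|ny]; first by apply: Alt; lia.
  by apply: Br; lia.
Qed.

Lemma merge_inv_right k i j mid hi B :
  merge_inv k i j mid hi B -> j < hi ->
  (i < mid -> (key (A j) <= key (A i))%R) ->
  merge_inv k.+1 i j.+1 mid hi (upd B k (A j)).
Proof.
move=> [q [q' [[h1 h2 h3 h4 [h5 h6]] [As1 As2] Bs Bo [cont Br]]]] im Aij.
exists q, q'; split=> //.
- by split=> //; lia.
- apply: (@blocks_sorted_push _ q) => //; first by lia.
  by move=> x /Bo [_ h]; apply: h.
- move=> x hx; rewrite /upd; case: eqVneq => [_|nx].
    by split=> // h; apply: As2 => //; lia.
  have {}/Bo[hi1 hi2] : q * (w + w) <= x < k by lia.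
  split=> // h; apply: le_trans (hi2 im) _; apply: As2; lia.
- split=> [x hx|y hy]; rewrite /upd.
    have [->|nx] := eqVneq x j; first by exists k; rewrite ?eqxx.
    have [|y hy <-] := cont x; first by lia.
    by exists y; [lia|rewrite ifF //; lia].
  case: eqVneq => [_|ny]; first by apply: Alt; lia.
  by apply: Br; lia.
Qed.

(** At [k = n], the equation [k + mid = i + j] forces [i = mid] and [j = hi = n], so every position
    has been read. *)
Lemma merge_inv_end i j mid hi B :
  merge_inv n i j mid hi B ->
  [/\ blocks_sorted (w + w) n B, forall y, y < n -> B y < n
    & forall x, x < n -> exists2 y, y < n & B y = A x].
Proof.
move=> [q [q' [[h1 h2 h3 h4 _] _ Bs _ [cont Br]]]]; split=> //.
by move=> x hx; apply: cont; lia.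
Qed.

End MergeInvariant.

Definition ILt (e1 e2 : iexp) : bexp := BNot (ILe e2 e1).
(** Truncation at 0 in [ISub] makes this the minimum. *)
Definition IMin (e1 e2 : iexp) : iexp := ISub e1 (ISub e1 e2).

(* Integer registers: 2 output position, 3 block width, 4 and 5 read positions
   in the two blocks being merged, 6 and 7 the ends of these blocks. *)
Definition merge_open : cmd :=
  If (ILe (IReg 7) (IReg 2))
    (Seq (ISet 4 (IReg 2))
    (Seq (ISet 6 (IMin (IAdd (IReg 2) (IReg 3)) (IReg 0)))
    (Seq (ISet 5 (IReg 6))
         (ISet 7 (IMin (IAdd (IReg 6) (IReg 3)) (IReg 0))))))
    Skip.

(** Written with negation and conjunction only, the test says that the left block is not exhausted,
    and that the right block is exhausted or its head is not smaller. *)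
Definition merge_choose (kap a : nat) : cmd :=
  If (BAnd (ILt (IReg 4) (IReg 6))
           (BNot (BAnd (ILt (IReg 5) (IReg 7))
                       (BNot (RLe (RGet kap (IGet a (IReg 4)))
                                  (RGet kap (IGet a (IReg 5))))))))
    (Seq (IPut 4 (IReg 2) (IGet a (IReg 4))) (ISet 4 (IAdd (IReg 4) (ICst 1))))
    (Seq (IPut 4 (IReg 2) (IGet a (IReg 5))) (ISet 5 (IAdd (IReg 5) (ICst 1)))).

Definition merge_step (kap a : nat) : cmd := Seq merge_open (merge_choose kap a).

Definition merge_pass (kap a : nat) : cmd :=
  Seq (ISet 7 (ICst 0))
  (Seq (ISet 4 (ICst 0))
  (Seq (ISet 5 (ICst 0))
  (Seq (ISet 6 (ICst 0))
  (Seq (For 2 (merge_step kap a))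
       (For 2 (IPut a (IReg 2) (IGet 4 (IReg 2)))))))).

(** Integer array [a] lists indices, sorted by their keys in real array [kap]; integer array 4 is
    the buffer. *)
Definition merge_sort (kap a : nat) : cmd :=
  Seq (For 2 (IPut a (IReg 2) (IReg 2)))
  (Seq (ISet 3 (ICst 1))
       (While (ILt (IReg 3) (IReg 0))
          (Seq (merge_pass kap a) (ISet 3 (IAdd (IReg 3) (IReg 3)))))).

Section MergeSort.
Variables (R : realType) (n kap a : nat).
Hypotheses (n0 : 0 < n) (a4 : a != 4).
Implicit Types s : state R.

Let a4F : (a == 4) = false. Proof. exact: negPf. Qed.
Let a4F' : (4 == a) = false. Proof. by rewrite eq_sym. Qed.

Lemma merge_step_runs (key : nat -> R) w A k s :
  0 < w -> (forall x, x < n -> A x < n) -> blocks_sorted key w n A -> k < n ->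
  rarr s kap = key -> iarr s a = A -> ireg s 0 = n -> ireg s 2 = k -> ireg s 3 = w ->
  merge_inv n key w A k (ireg s 4) (ireg s 5) (ireg s 6) (ireg s 7) (iarr s 4) ->
  runs (merge_step kap a) s 72 (fun s' =>
    merge_inv n key w A k.+1 (ireg s' 4) (ireg s' 5) (ireg s' 6) (ireg s' 7)
      (iarr s' 4)).
Proof.
move=> w0 Alt Asort kn sk sA s0 s2 s3 inv.
have choose s1 : rarr s1 kap = key -> iarr s1 a = A -> ireg s1 2 = k ->
    k < ireg s1 7 ->
    merge_inv n key w A k (ireg s1 4) (ireg s1 5) (ireg s1 6) (ireg s1 7) (iarr s1 4) ->
    wpl (merge_choose kap a) s1 (fun s' =>
      merge_inv n key w A k.+1 (ireg s' 4) (ireg s' 5) (ireg s' 6) (ireg s' 7)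
        (iarr s' 4)).
  move=> /= -> s1A -> k7 inv1; rewrite !s1A; split.
    rewrite -ltnNge => /andP[lt46]; rewrite negb_and !negbK => /orP hk.
    rewrite addn1; apply: merge_inv_left => // lt57.
    by case: hk => //; lia.
  rewrite -ltnNge negb_and -leqNgt !negbK => hk.
  have [q [q' [[h1 h2 h3 h4 _] _ _ _ _]]] := inv1.
  rewrite addn1; apply: merge_inv_right => //.
    case/orP: hk => [|/andP[]]; lia.
  by case/orP: hk => [|/andP[_]]; [lia|rewrite -ltNge => /ltW].
suff h : wpl (merge_step kap a) s (fun s' =>
    merge_inv n key w A k.+1 (ireg s' 4) (ireg s' 5) (ireg s' 6) (ireg s' 7)
      (iarr s' 4)) by apply: runs_loopfree.
rewrite /merge_step /merge_open; cbn [wpl]; split=> h7.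
  move: h7; rewrite [beval _ _]/= s2 => h7; apply: choose => //=; rewrite ?s0 ?s2 ?s3.
    by lia.
  have := merge_inv_block w0 Asort inv.
  have -> : k + w - (k + w - n) = minn (k + w) n by lia.
  have -> x : x + w - (x + w - n) = minn (x + w) n by lia.
  by apply; lia.
by move: h7; rewrite [beval _ _]/= -ltnNge s2 => h7; apply: choose.
Qed.

Lemma merge_pass_runs (key : nat -> R) w A s :
  0 < w -> (forall x, x < n -> A x < n) -> blocks_sorted key w n A ->
  rarr s kap = key -> iarr s a = A -> ireg s 0 = n -> ireg s 3 = w ->
  runs (merge_pass kap a) s (n * 150) (fun s' =>
    [/\ blocks_sorted key (w + w) n (iarr s' a),
        forall x, x < n -> iarr s' a x < n
      & forall x, x < n -> exists2 y, y < n & iarr s' a y = A x]).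
Proof.
move=> w0 Alt Asort sk sA s0 s3.
rewrite /merge_pass.
do 4! [apply: runs_seq_wpl => /=; first lia].
apply: (@runs_seq _ (n * 88)); first lia.
set s1 := set_ireg _ _ _.
have := @runs_for R (fun k s' => merge_inv n key w A k (ireg s' 4) (ireg s' 5)
    (ireg s' 6) (ireg s' 7) (iarr s' 4)) 2 (merge_step kap a) 72 n s1.
move=> H; apply: (runs_weaken (H _ _ _ _ _ _ _)) => //.
- exact: merge_inv0.
- move=> k s2 kn [e0 _ e2 e3] s22 inv.
  apply: (@merge_step_runs key w A k) => //; rewrite ?e0 ?e3 //.
  by rewrite e2 //= !inE !xpair_eqE a4F.
move=> s2 [e0 _ e2 e3] /merge_inv_end[]; set B := iarr s2 4 => Bs Br Bc.
apply: (@runs_weaken _ _ _ (n * 21) _ (fun s' => forall x, x < n -> iarr s' a x = B x)).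
- apply: (runs_for (B := 5) (I := fun k s' => forall x, x < k -> iarr s' a x = B x)) => //.
    by rewrite e0.
  move=> k s4 kn [_ _ f2 _] s42 Ik.
  apply: runs_loopfree => //.
  move=> x hx; rewrite /= eqxx /= s42; case: eqP => [->|nx]; last by apply: Ik; lia.
  by rewrite f2 //= !inE !xpair_eqE a4F'.
- by lia.
- move=> s4 _ E; split=> [q x y h1 h2 h3 h4|x hx|x hx].
  + by rewrite !E; [apply: (Bs q)|lia|lia].
  + by rewrite E //; apply: Br.
  + by have [y hy <-] := Bc x hx; exists y; rewrite ?E.
Qed.

Lemma merge_sort_runs s :
  ireg s 0 = n ->
  runs (merge_sort kap a) s (200 * (n * (trunc_log 2 n).+1)) (fun s' =>
    [/\ forall x y, x <= y -> y < n ->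
          (rarr s kap (iarr s' a x) <= rarr s kap (iarr s' a y))%R,
        forall x, x < n -> iarr s' a x < n
      & forall v, v < n -> exists2 x, x < n & iarr s' a x = v]).
Proof.
move=> s0; set key := rarr s kap.
apply: (@runs_seq _ (n * 21)); first by lia.
apply: (@runs_weaken _ _ _ (n * 21) _ (fun s' => forall x, x < n -> iarr s' a x = x)) => //.
  apply: (runs_for (B := 5) (I := fun k s' => forall x, x < k -> iarr s' a x = x)) => //.
  move=> k s4 kn [_ _ f2 _] s42 Ik.
  apply: runs_loopfree => //.
  move=> x hx; rewrite /= eqxx /= s42; case: eqP => // nx; by apply: Ik; lia.
move=> s1 [e0 _ e2 e3] sA.
apply: runs_seq_wpl; first by rewrite /=; lia.
rewrite [wpl _ _ _]/=; set s2 := set_ireg _ _ _.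
(* [k] bounds the remaining rounds: each doubles [w], and the loop stops once [w] reaches [n]. *)
pose I k s' := exists w, [/\ ireg s' 3 = w, 0 < w, n < w * 2 ^ k &
  [/\ blocks_sorted key w n (iarr s' a), forall x, x < n -> iarr s' a x < n
      & forall v, v < n -> exists2 x, x < n & iarr s' a x = v]].
have W := @runs_while R I (ILt (IReg 3) (IReg 0))
  (Seq (merge_pass kap a) (ISet 3 (IAdd (IReg 3) (IReg 3)))) (n * 150 + 4) s2
  (trunc_log 2 n).+1.
apply: (runs_weaken (W _ _)).
- move=> k s3 [f0 _ _ f3] [w [s33 w0 nw [As Ar Ac]]].
  have s30 : ireg s3 0 = n by rewrite f0 //= e0.
  have s3k : rarr s3 kap = key by rewrite f3 //= e3.
  rewrite /= s33 s30 -ltnNge => wn.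
  case: k nw => [|k] nw; first by lia.
  exists k => //.
  apply: (@runs_seq _ (n * 150)); first by lia.
  apply: (runs_weaken (merge_pass_runs w0 Ar As s3k (erefl _) s30 s33)) => //.
  move=> s4 [g0 _ _ _] [Bs Br Bc].
  rewrite addKn; apply: runs_loopfree => //=.
  have s43 : ireg s4 3 = w by rewrite g0.
  exists (w + w); split=> //=.
  + by rewrite s43.
  + lia.
  + by move: nw; rewrite expnS; lia.
  + split=> // v /Ac[x xn <-]; exact: Bc.
- exists 1; split=> //=.
    by rewrite mul1n; apply: trunc_log_ltn.
  split=> [q x y h1 h2 h3 h4|x hx|v hv].
  + by have -> : x = y by lia.
  + by rewrite sA.
  + by exists v; rewrite ?sA.
- have : trunc_log 2 n <= n * trunc_log 2 n by rewrite leq_pmull.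
  by rewrite /=; lia.
- move=> s3 [f0 _ _ _] [h [k [w [s33 w0 nw [As Ar Ac]]]]]; split=> // x y xy yn.
  (* On exit [n <= w], so block 0 is the whole array. *)
  apply: (As 0) => //; rewrite mul0n //.
  move: h; rewrite /= negbK s33 f0 //= e0 // s0; lia.
Qed.

End MergeSort.

(** * Preprocessing *)

(* Integer array 1 holds an ancestor of each node, real array 5 the distance to
   it; the ancestor is replaced by its own ancestor until it is the root. *)
Definition doubling_step : cmd :=
  Seq (RPut 5 (IReg 2) (RAdd (RGet 5 (IReg 2)) (RGet 5 (IGet 1 (IReg 2)))))
      (IPut 1 (IReg 2) (IGet 1 (IGet 1 (IReg 2)))).

(** Depths are stored as reals because [merge_sort] compares real keys. The root has distance 0 to
    itself, so doubling leaves its entry unchanged. *)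
Definition depths : cmd :=
  Seq (For 2 (Seq (IPut 1 (IReg 2) (IGet 0 (IReg 2)))
                  (RPut 5 (IReg 2) (RCst 1))))
  (Seq (RPut 5 (ICst 0) (RCst 0))
  (Seq (ISet 3 (ICst 1))
       (While (ILt (IReg 3) (IReg 0))
          (Seq (For 2 doubling_step) (ISet 3 (IAdd (IReg 3) (IReg 3))))))).

(* Marks in integer array 5 the nodes other than the root on the path to the
   designated leaf, and in integer array 6 the inner nodes. *)
Definition mark_path : cmd :=
  Seq (ISet 2 (IReg 1))
      (While (ILe (ICst 1) (IReg 2))
         (Seq (IPut 5 (IReg 2) (ICst 1)) (ISet 2 (IGet 0 (IReg 2))))).

Definition mark_inner : cmd :=
  For 2 (If (ILe (ICst 1) (IReg 2)) (IPut 6 (IGet 0 (IReg 2)) (ICst 1)) Skip).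

Section Preprocessing.
Variables (R : realType) (n : nat) (P dpt : nat -> nat).
Hypothesis n0 : 0 < n.
Implicit Types s : state R.

Lemma mark_inner_runs s : ireg s 0 = n -> iarr s 0 = P ->
  (forall v, iarr s 6 v = 0) ->
  runs mark_inner s (n * 30) (fun s' =>
    forall v, 0 < iarr s' 6 v <-> exists2 x, 0 < x < n & P x = v).
Proof.
move=> s0 sP s6.
pose I k s' := forall v, 0 < iarr s' 6 v <-> exists2 x, 0 < x < k & P x = v.
apply: (runs_weaken (runs_for (B := 12) (I := I) s0 _ _ _ n0 _ _)) => //.
  by move=> v /=; rewrite s6; split=> // -[x]; lia.
  move=> k s1 kn [_ _ e2 _] s12 Ik; have sP1 : iarr s1 0 = P by rewrite e2.
  apply: runs_loopfree => //=; rewrite /I /= s12 sP1; split=> k0 v.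
    case: eqVneq => [->|nv]; first by split=> // _; exists k; rewrite ?k0 /=.
    rewrite Ik; split=> -[x hx xv]; exists x => //; first by lia.
    suff : x != k by lia.
    by apply: contra nv => /eqP <-; rewrite xv.
  by rewrite Ik; split=> -[x hx xv]; exists x => //; lia.
by lia.
Qed.

Hypotheses (P0 : P 0 = 0) (Plt : forall v, v < n -> P v < n).
Hypotheses (dpt0 : dpt 0 = 0)
  (dptS : forall v, 0 < v < n -> dpt v = (dpt (P v)).+1)
  (dptlt : forall v, v < n -> dpt v < n).

(** Entries are updated in place, so a jump may already use a doubled entry of an ancestor. Hence
    its length [k] is only bounded below, by [w] or by the depth if that is smaller. *)
Definition partial_depth (w : nat) s v : Prop :=
  exists k, [/\ rarr s 5 v = k%:R%R, k + dpt (iarr s 1 v) = dpt v,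
                minn w (dpt v) <= k & iarr s 1 v < n].

(** The jumps from [v] and from its recorded ancestor have lengths [k] and [k']; unless one of them
    ends at the root, both are at least [w]. *)
Lemma doubling_step_runs w s v : v < n -> ireg s 2 = v ->
  (forall x, x < n -> partial_depth w s x) ->
  (forall x, x < v -> partial_depth (w + w) s x) ->
  runs doubling_step s 16 (fun s' =>
    (forall x, x < n -> partial_depth w s' x) /\
    (forall x, x < v.+1 -> partial_depth (w + w) s' x)).
Proof.
move=> vn s2 pd pd2.
have [k [kr kd kw kn]] := pd v vn.
have [k' [kr' kd' kw' kn']] := pd _ kn.
apply: runs_loopfree => //=.
(* The new entry of [v] meets both requirements: [w], asked of all nodes, and [w + w], asked of the
   nodes already treated. *)
have new w' : w' <= w + w -> partial_depth w'
   (set_iarr (set_rarr s 5 v (rarr s 5 v + rarr s 5 (iarr s 1 v))%R) 1 v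
        (iarr s 1 (iarr s 1 v))) v.
  move=> hw; exists (k + k'); rewrite /= eqxx; split=> //.
  - by rewrite kr kr' natrD.
  - lia.
  - lia.
rewrite s2; split=> x hx; have [->|nx] := eqVneq x v.
- by apply: new; lia.
- by rewrite /partial_depth /= (negPf nx); apply: pd.
- by apply: new; lia.
- by rewrite /partial_depth /= (negPf nx); apply: pd2; lia.
Qed.

Lemma depths_runs s : ireg s 0 = n -> iarr s 0 = P ->
  runs depths s (100 * (n * (trunc_log 2 n).+1)) (fun s' =>
    forall v, v < n -> rarr s' 5 v = (dpt v)%:R%R).
Proof.
move=> s0 sP.
apply: (@runs_seq _ (n * 26)); first by lia.
apply: (@runs_weaken _ _ _ (n * 26) _ (fun s' => forall x, x < n ->
    iarr s' 1 x = P x /\ rarr s' 5 x = 1%R)) => //.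
  apply: (runs_for (B := 10) (I := fun k s' => forall x, x < k ->
    iarr s' 1 x = P x /\ rarr s' 5 x = 1%R)) => //.
  move=> k s1 kn [_ _ e2 _] s12 Ik; apply: runs_loopfree => //= x hx.
  rewrite s12; case: eqVneq => [->|nx]; last by apply: Ik; lia.
  by rewrite e2 // sP.
move=> s1 [e0 _ e2 _] s1A.
apply: runs_seq_wpl; first by rewrite /=; lia.
rewrite [wpl _ _ _]/=.
apply: runs_seq_wpl; first by rewrite /=; lia.
rewrite [wpl _ _ _]/=; set s2 := set_ireg _ _ _.
pose I k s' := exists w, [/\ ireg s' 3 = w, 0 < w, n < w * 2 ^ k &
  forall x, x < n -> partial_depth w s' x].
have W := @runs_while R I (ILt (IReg 3) (IReg 0))
  (Seq (For 2 doubling_step) (ISet 3 (IAdd (IReg 3) (IReg 3)))) (n * 32 + 4) s2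
  (trunc_log 2 n).+1.
apply: (runs_weaken (W _ _)).
- move=> k s3 [f0 _ _ f3] [w [s33 w0 nw pd]].
  have s30 : ireg s3 0 = n by rewrite f0 //= e0.
  rewrite /= s33 s30 -ltnNge => wn.
  case: k nw => [|k] nw; first by lia.
  exists k => //.
  apply: (@runs_seq _ (n * 32)); first by lia.
  apply: (runs_weaken (runs_for (B := 16) (I := fun k s' =>
     (forall x, x < n -> partial_depth w s' x) /\
     (forall x, x < k -> partial_depth (w + w) s' x)) s30 _ _ _ n0 _ _)) => //.
    move=> v s4 vn [_ _ _ _] s42 [pd1 pd2].
    exact: (runs_weaken (doubling_step_runs vn s42 pd1 pd2)).
  move=> s4 [g0 _ _ _] [_ pd2]; rewrite addKn; apply: runs_loopfree => //=.
  have s43 : ireg s4 3 = w by rewrite g0.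
  exists (w + w); split=> //=.
  + by rewrite s43.
  + lia.
  + by move: nw; rewrite expnS; lia.
- exists 1; split=> //=; first by rewrite mul1n; apply: trunc_log_ltn.
  move=> x xn; have [A1 A5] := s1A _ xn; rewrite /partial_depth /=.
  have [->|x0] := posnP x.
    by exists 0; have [-> _] := s1A _ n0; rewrite P0 dpt0; split.
  exists 1; rewrite A1 A5; split=> //.
  + by rewrite [RHS]dptS ?x0.
  + lia.
  + exact: Plt.
- have : trunc_log 2 n <= n * trunc_log 2 n by rewrite leq_pmull.
  by rewrite /=; lia.
- move=> s3 [f0 _ _ _] [h [k [w [s33 w0 nw pd]]]] v vn.
  (* On exit [w >= n] exceeds all depths, so the jump from [v] covers its whole depth. *)
  have [j [-> jd jw _]] := pd v vn; congr (_%:R)%R.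
  have := dptlt vn; move: h; rewrite /= negbK s33 f0 //= e0 // s0; lia.
Qed.

Lemma mark_path_runs t s : t < n -> ireg s 1 = t -> iarr s 0 = P ->
  (forall v, iarr s 5 v = 0) ->
  runs mark_path s (n * 20) (fun s' =>
    forall v, 0 < iarr s' 5 v <-> 0 < v /\ exists j, v = iter j P t).
Proof.
move=> tn s1 sP s5.
apply: runs_seq_wpl; first by rewrite /=; lia.
rewrite [wpl _ _ _]/=; set s2 := set_ireg _ _ _.
(* Register 2 climbs from [t], and its depth bounds the remaining rounds. Every iterate of [P] on
   [t] is marked already or still ahead of register 2. *)
pose I k s' := [/\ ireg s' 2 < n, dpt (ireg s' 2) <= k,
  exists j, ireg s' 2 = iter j P t,
  forall v, 0 < iarr s' 5 v -> 0 < v /\ exists j, v = iter j P t &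
  forall j, (0 < iarr s' 5 (iter j P t)) \/ exists i, iter j P t = iter i P (ireg s' 2)].
apply: (runs_weaken (@runs_while R I (ILe (ICst 1) (IReg 2)) _ 7 s2 n.-1 _ _)).
- move=> k s3 [_ _ e2 _] [xn xk [j xj] h1 h2] /= x0.
  have sP3 : iarr s3 0 = P by rewrite e2.
  have dx := dptS (v := ireg s3 2).
  exists k.-1; first by lia.
  apply: runs_loopfree => //=; rewrite /I /= sP3; split.
  + exact: Plt.
  + lia.
  + by exists j.+1; rewrite xj.
  + move=> v; case: eqVneq => [-> _|_ /h1 //]; split=> //.
    by exists j.
  + move=> i; case: eqVneq => [_|ni]; first by left.
    have [|[i' Ei]] := h2 i; [by left|right].
    case: i' Ei => [Ei|i' ->]; first by rewrite /= in Ei; rewrite Ei eqxx in ni.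
    by exists i'; rewrite iterSr.
- rewrite /I /= s1; split=> //.
  + have := dptlt tn; lia.
  + by exists 0.
  + by move=> v; rewrite s5.
  + by move=> j; right; exists j.
- by rewrite /=; lia.
- move=> s3 _ [x0 [k [_ _ _ h1 h2]]] v; split; first exact: h1.
  move=> [v0 [j vj]]; have [|[i]] := h2 j; first by rewrite vj.
  move: x0; rewrite /= -leqNgt leqn0 => /eqP ->.
  have -> : iter i P 0 = 0 by elim: i => //= i ->.
  by lia.
Qed.

End Preprocessing.

(** * Testing a threshold *)

(* Real register 1 is the threshold.  Real arrays 6 and 7 receive the largest and
   smallest distances from the root that are possible when only the edges of
   cost at most the threshold may change, real array 8 the largest distances
   that are compatible with distance D to the designated leaf. *)
Definition extreme_step : cmd :=
  let v := IReg 8 in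
  let pv := IGet 0 v in
  Seq (ISet 8 (IGet 2 (IReg 2)))
  (If (ILe (ICst 1) v)
     (If (RLe (RGet 3 v) (RReg 1))
        (Seq (RPut 6 v (RAdd (RGet 6 pv) (RGet 2 v)))
             (RPut 7 v (RAdd (RGet 7 pv) (RGet 0 v))))
        (Seq (RPut 6 v (RAdd (RGet 6 pv) (RGet 1 v)))
             (RPut 7 v (RAdd (RGet 7 pv) (RGet 1 v)))))
     Skip).

(** Off the path, a difference of two entries of array 6 recovers the upper bound of the edge under
    the threshold, without testing its cost again. *)
Definition dist_step : cmd :=
  let v := IReg 8 in
  let pv := IGet 0 v in
  let b := RAdd (RGet 7 v) (RSub (RReg 0) (RGet 7 (IReg 1))) in
  Seq (ISet 8 (IGet 2 (IReg 2)))
  (If (ILe (ICst 1) v)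
     (If (ILe (ICst 1) (IGet 5 v))
        (If (RLe (RGet 6 v) b) (RPut 8 v (RGet 6 v)) (RPut 8 v b))
        (RPut 8 v (RAdd (RGet 8 pv) (RSub (RGet 6 v) (RGet 6 pv)))))
     Skip).

(** Register 9 is the verdict of the test. A node unmarked in array 6 is a leaf, and it must admit a
    distance of at least [D]. *)
Definition check_leaf : cmd :=
  If (BAnd (ILe (IGet 6 (IReg 2)) (ICst 0))
           (BNot (RLe (RReg 0) (RGet 8 (IReg 2)))))
     (ISet 9 (ICst 0)) Skip.

Definition check_leaves : cmd :=
  Seq (If (BAnd (RLe (RGet 7 (IReg 1)) (RReg 0)) (RLe (RReg 0) (RGet 6 (IReg 1))))
          (ISet 9 (ICst 1)) (ISet 9 (ICst 0)))
      (For 2 check_leaf).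

Definition test : cmd :=
  Seq (For 2 extreme_step) (Seq (For 2 dist_step) check_leaves).

Section Test.
Variables (R : realType) (n : nat) (P dpt by_depth : nat -> nat).
Hypotheses (n0 : 0 < n) (dptS : forall v, 0 < v < n -> dpt v = (dpt (P v)).+1).
Hypotheses (Olt : forall x, x < n -> by_depth x < n)
  (Osort : forall x y, x <= y -> y < n -> dpt (by_depth x) <= dpt (by_depth y))
  (Osurj : forall v, v < n -> exists2 x, x < n & by_depth x = v).
Implicit Types s : state R.

(* Nodes are visited by increasing depth, so an assignment to the current node
   does not disturb the recurrence at the nodes visited before. *)
Lemma parent_later j k : j < k -> k < n -> 0 < by_depth j -> P (by_depth j) != by_depth k.
Proof.
move=> jk kn Oj0; apply/eqP => E.
have := Osort (ltnW jk) kn; rewrite dptS ?Oj0 ?Olt ?E; lia.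
Qed.

Lemma parent_neq v : 0 < v < n -> P v != v.
Proof. by move=> hv; apply/eqP => E; have := dptS hv; rewrite E; lia. Qed.

Definition upper (s : state R) v : R :=
  (if rarr s 3 v <= rreg s 1 then rarr s 2 v else rarr s 1 v)%R.
Definition lower (s : state R) v : R :=
  (if rarr s 3 v <= rreg s 1 then rarr s 0 v else rarr s 1 v)%R.

Lemma extreme_runs s : ireg s 0 = n -> iarr s 0 = P -> iarr s 2 = by_depth ->
  rarr s 6 0 = 0%R -> rarr s 7 0 = 0%R ->
  runs (For 2 extreme_step) s (n * 70) (fun s' =>
    [/\ rarr s' 6 0 = 0%R, rarr s' 7 0 = 0%R & forall v, 0 < v < n ->
     (rarr s' 6 v = rarr s' 6 (P v) + upper s v)%R /\
     (rarr s' 7 v = rarr s' 7 (P v) + lower s v)%R]).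
Proof.
move=> s0 sP sO s60 s70.
(* The invariant is the recurrence itself at the visited nodes, not a closed form of the distances;
   later assignments preserve it by [parent_later]. *)
pose I k s' := [/\ rarr s' 6 0 = 0%R, rarr s' 7 0 = 0%R & forall j, j < k -> 0 < by_depth j ->
     (rarr s' 6 (by_depth j) = rarr s' 6 (P (by_depth j)) + upper s (by_depth j))%R /\
     (rarr s' 7 (by_depth j) = rarr s' 7 (P (by_depth j)) + lower s (by_depth j))%R].
apply: (runs_weaken (runs_for (B := 54) (I := I) s0 _ _ _ n0 _ _)) => //.
- move=> k s1 kn [e0 e1 e2 e3] s12 [z6 z7 Ik].
  have sP1 : iarr s1 0 = P by rewrite e2.
  have sO1 : iarr s1 2 = by_depth by rewrite e2.
  apply: runs_loopfree => //=; rewrite s12 sP1 sO1 (e3 0) // !(e3 1) // (e3 2) // (e3 3) // !e1 //.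
  have new x y : 0 < by_depth k -> upper s (by_depth k) = x -> lower s (by_depth k) = y ->
     I k.+1 (set_ireg (set_rarr (set_rarr (set_ireg s1 8 (by_depth k)) 6 (by_depth k)
        (rarr s1 6 (P (by_depth k)) + x)%R) 7 (by_depth k) (rarr s1 7 (P (by_depth k)) + y)%R) 2 k.+1).
    move=> Ok0 Ex Ey; rewrite /I /=.
    have -> : (0 == by_depth k) = false by lia.
    split=> // j jk Oj0; have [->|jk'] := eqVneq j k.
      by rewrite eqxx (negPf (parent_neq _)) ?Ex ?Ey // Ok0 Olt.
    rewrite (negPf (@parent_later j k _ _ _)) //; last by lia.
    (* [by_depth] is assumed onto, not injective, so an earlier visit to the same node is treated
       here. *)
    case: eqVneq => [Ejk|_]; last by apply: Ik => //; lia.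
    by rewrite -Ejk -Ex -Ey Ejk.
  split=> Ok0; last first.
    split=> //= j jk Oj0; apply: Ik => //; suff : j != k by lia.
    by apply/eqP => E; move: Ok0; rewrite -E Oj0.
  by split=> hc; apply: new; rewrite // /upper /lower ?hc // (negPf hc).
- move=> s1 _ [z6 z7 In]; split=> // v /andP[v0 vn].
  by have [j jn E] := Osurj vn; have := In j jn; rewrite E => /(_ v0).
Qed.

Lemma dist_runs s t onp : ireg s 0 = n -> iarr s 0 = P -> iarr s 2 = by_depth ->
  ireg s 1 = t -> iarr s 5 = onp -> rarr s 8 0 = 0%R ->
  runs (For 2 dist_step) s (n * 70) (fun s' =>
    rarr s' 8 0 = 0%R /\ forall v, 0 < v < n ->
      (rarr s' 8 v = if (0 < onp v)%N
       then Num.min (rarr s 6 v) (rarr s 7 v + (rreg s 0 - rarr s 7 t))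
       else rarr s' 8 (P v) + (rarr s 6 v - rarr s 6 (P v)))%R).
Proof.
move=> s0 sP sO st sonp s80.
pose val s' v := (if (0 < onp v)%N
       then Num.min (rarr s 6 v) (rarr s 7 v + (rreg s 0 - rarr s 7 t))
       else rarr s' 8 (P v) + (rarr s 6 v - rarr s 6 (P v)))%R.
pose I k s' := rarr s' 8 0 = 0%R /\
   forall j, j < k -> 0 < by_depth j -> rarr s' 8 (by_depth j) = val s' (by_depth j).
apply: (runs_weaken (runs_for (B := 54) (I := I) s0 _ _ _ n0 _ _)) => //.
- move=> k s1 kn [e0 e1 e2 e3] s12 [z8 Ik].
  have sP1 : iarr s1 0 = P by rewrite e2.
  have sO1 : iarr s1 2 = by_depth by rewrite e2.
  have st1 : ireg s1 1 = t by rewrite e0.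
  have sonp1 : iarr s1 5 = onp by rewrite e2.
  apply: runs_loopfree => //=; rewrite s12 sP1 sO1 st1 sonp1 !(e3 6) // !(e3 7) // !e1 //.
  have new x : 0 < by_depth k -> val s1 (by_depth k) = x ->
     I k.+1 (set_ireg (set_rarr (set_ireg s1 8 (by_depth k)) 8 (by_depth k) x) 2 k.+1).
    move=> Ok0 Ex; rewrite /I /val /=.
    have -> : (0 == by_depth k) = false by lia.
    split=> // j jk Oj0; have [->|jk'] := eqVneq j k.
      by rewrite eqxx (negPf (parent_neq _)) -?Ex // Ok0 Olt.
    rewrite (negPf (@parent_later j k _ _ _)) //; last by lia.
    case: eqVneq => [Ejk|_]; last by apply: Ik => //; lia.
    by rewrite -Ex Ejk.
  split=> Ok0; last first.
    split=> //= j jk Oj0; apply: Ik => //; suff : j != k by lia.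
    by apply/eqP => E; move: Ok0; rewrite -E Oj0.
  split=> ho; last by apply: new; rewrite // /val (negPf ho).
  split=> hc; apply: new; rewrite // /val ho; first by rewrite min_l.
  by rewrite min_r // ltW // ltNge.
- move=> s1 _ [z8 In]; split=> // v /andP[v0 vn].
  by have [j jn E] := Osurj vn; have := In j jn; rewrite E => /(_ v0).
Qed.

Lemma check_leaves_runs s t : ireg s 0 = n -> ireg s 1 = t ->
  runs check_leaves s (n * 50) (fun s' =>
    0 < ireg s' 9 <-> (rarr s 7 t <= rreg s 0 <= rarr s 6 t)%R /\
      forall v, v < n -> iarr s 6 v = 0 -> (rreg s 0 <= rarr s 8 v)%R).
Proof.
move=> s0 st.
pose b := (rarr s 7 t <= rreg s 0 <= rarr s 6 t)%R.
pose I k s' := 0 < ireg s' 9 <-> b /\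
      forall v, v < k -> iarr s 6 v = 0 -> (rreg s 0 <= rarr s 8 v)%R.
have main s1 : agree [:: (0, 9)] s s1 -> ireg s1 9 = b ->
    runs (For 2 check_leaf) s1 (n * 32) (I n).
  move=> [e0 e1 e2 e3] s19.
  apply: (runs_weaken (runs_for (B := 16) (I := I) (n := n) _ _ _ _ n0 _ _)) => //.
  - by rewrite e0.
  - by rewrite /I /= s19 lt0b; split=> [->|[]].
  - move=> k s2 kn [f0 f1 f2 f3] s22 Ik.
    apply: runs_loopfree => //=; rewrite s22 !f2 // !e2 // !f1 // !e1 // !f3 // !e3 //.
    rewrite /I /=; split=> [/andP[le0 hD]|].
      split=> // -[_] /(_ k (leqnn _)) h; move: hD; rewrite h //; lia.
    rewrite negb_and negbK => h; split=> [/Ik[hb hl]|[hb hl]].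
      split=> // v hv v6; have [vk|] := eqVneq v k; first by move: h; rewrite -vk v6.
      by move=> ?; apply: hl => //; lia.
    by apply/Ik; split=> // v hv; apply: hl; lia.
apply: runs_seq_wpl; first by rewrite /=; lia.
have {}main x : x = b :> nat ->
    runs (For 2 check_leaf) (set_ireg s 9 x) (n * 32) (I n).
  by move=> ->; apply: main => //; split=> //= y; rewrite inE xpair_eqE /= => /negPf ->.
rewrite [wpl _ _ _]/= st; split=> hb.
  by apply: (runs_weaken (main 1 _)) => //; [rewrite /b hb|lia].
by apply: (runs_weaken (main 0 _)) => //; [rewrite /b (negPf hb)|lia].
Qed.

Lemma test_runs s t onp : ireg s 0 = n -> iarr s 0 = P -> iarr s 2 = by_depth ->
  ireg s 1 = t -> iarr s 5 = onp ->
  rarr s 6 0 = 0%R -> rarr s 7 0 = 0%R -> rarr s 8 0 = 0%R ->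
  runs test s (n * 200) (fun s' =>
    [/\ [/\ rarr s' 6 0 = 0%R, rarr s' 7 0 = 0%R & rarr s' 8 0 = 0%R],
        forall v, 0 < v < n ->
          [/\ rarr s' 6 v = rarr s' 6 (P v) + upper s v,
              rarr s' 7 v = rarr s' 7 (P v) + lower s v
            & rarr s' 8 v = if (0 < onp v)%N
              then Num.min (rarr s' 6 v) (rarr s' 7 v + (rreg s 0 - rarr s' 7 t))
              else rarr s' 8 (P v) + (rarr s' 6 v - rarr s' 6 (P v))]%R
      & 0 < ireg s' 9 <-> (rarr s' 7 t <= rreg s 0 <= rarr s' 6 t)%R /\
          forall v, v < n -> iarr s 6 v = 0 -> (rreg s 0 <= rarr s' 8 v)%R]).
Proof.
move=> s0 sP sO st sonp z6 z7 z8.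
apply: (@runs_seq _ (n * 70)); first by lia.
apply: (runs_weaken (extreme_runs s0 sP sO z6 z7)) => // s1 [a0 a1 a2 a3] [y6 y7 hE].
apply: (@runs_seq _ (n * 70)); first by lia.
have a80 : rarr s1 8 0 = 0%R by rewrite a3.
apply: (runs_weaken (@dist_runs s1 t onp _ _ _ _ _ a80)); rewrite ?a0 ?a2 //.
move=> s2 [b0 b1 b2 b3] [y8 hD].
apply: (runs_weaken (@check_leaves_runs s2 t _ _)); rewrite ?b0 ?a0 //; first by lia.
move=> s3 [c0 c1 c2 c3] ok.
rewrite !c3 // !(b3 6) // !(b3 7) //; split=> //.
- move=> v hv; have [h6 h7] := hE v hv; split=> //.
  by rewrite hD // a1.
- by move: ok; rewrite (b3 6) // (b3 7) // b1 // a1 // b2 // a2.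
Qed.

End Test.

(** * Distances in rooted trees *)

Section Tree.
Variables (m : nat) (par : 'I_m -> 'I_m.+1).
Hypothesis rooted : rooted_tree par.

(** This is integer array 0 of the input, with the root as its own parent. *)
Definition parents : nat -> nat := edge_array 0 (fun e => nat_of_ord (par e)).

Lemma edge_array_child (T : Type) (x0 : T) (f : 'I_m -> T) (e : 'I_m) :
  edge_array x0 f (child e) = f e.
Proof. by rewrite lift0 /= valK. Qed.

Lemma parents_child e : parents (child e) = par e.
Proof. exact: edge_array_child. Qed.

Lemma parent_child e : parent par (child e) = par e.
Proof. by rewrite /parent liftK. Qed.

Lemma parent0 : parent par ord0 = ord0.
Proof. by rewrite /parent unlift_none. Qed.

Lemma childP (v : nat) : 0 < v < m.+1 -> {e : 'I_m | v = child e}.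
Proof.
move=> hv; have h : v.-1 < m by lia.
by exists (Ordinal h); rewrite lift0 /=; lia.
Qed.

Lemma parentsE (v : 'I_m.+1) : parents v = parent par v.
Proof.
case: (unliftP ord0 v) => [e|] ->; last by rewrite parent0.
by rewrite parents_child parent_child.
Qed.

Lemma iter_parents j (v : 'I_m.+1) : iter j parents v = iter j (parent par) v.
Proof. by elim: j => //= j ->; rewrite parentsE. Qed.

Lemma parents_lt v : v < m.+1 -> parents v < m.+1.
Proof. by move=> hv; rewrite (parentsE (Ordinal hv)). Qed.

Let rootedb v : exists k, iter k (parent par) v == ord0.
Proof. by have [k E] := rooted v; exists k; apply/eqP. Qed.

Definition depth (v : 'I_m.+1) : nat := ex_minn (rootedb v).

Lemma depth0 : depth ord0 = 0.
Proof. by rewrite /depth; case: ex_minnP => k _ /(_ 0 (eqxx _)); lia. Qed.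

Lemma depth_child e : depth (child e) = (depth (par e)).+1.
Proof.
rewrite /depth; case: ex_minnP => k kP kmin; case: ex_minnP => k' kP' kmin'.
case: k kP kmin => [|k] kP kmin; first by [].
have := kmin k'.+1; rewrite iterSr parent_child => /(_ kP').
have := kmin' k; rewrite -parent_child -iterSr => /(_ kP); lia.
Qed.

(** The root lies in the orbit of [v] under [parent], which has at most [m + 1] nodes. *)
Lemma depth_lt v : depth v < m.+1.
Proof.
have [k E] := rooted v.
have c0 : fconnect (parent par) v ord0 by rewrite -E fconnect_iter.
have lt : findex (parent par) v ord0 < m.+1.
  rewrite -[m.+1 in X in _ < X]card_ord.
  by apply: leq_trans (findex_max c0) (max_card _).
apply: leq_trans lt; rewrite ltnS /depth; case: ex_minnP => k' _; apply.
by rewrite iter_findex.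
Qed.

(** The induction is on depth, since the numbering of the nodes does not respect the tree order. *)
Lemma node_ind (Q : 'I_m.+1 -> Prop) :
  Q ord0 -> (forall e, Q (par e) -> Q (child e)) -> forall v, Q v.
Proof.
move=> Q0 QS v; have [k] := ubnP (depth v); elim: k v => // k IH v.
case: (unliftP ord0 v) => [e|] -> //.
by rewrite -/(child e) depth_child ltnS => ?; apply: QS; apply: IH.
Qed.

(** This excludes cycles: the root path of [par e] cannot contain [e], whose lower end is deeper. *)
Lemma depth_iter j u : depth (iter j (parent par) u) <= depth u.
Proof.
elim: j => //= j; apply: leq_trans.
case: (unliftP ord0 (iter j (parent par) u)) => [e|] ->; last by rewrite parent0.
by rewrite parent_child depth_child.
Qed.

Lemma root_path0 : root_path par ord0 = set0.
Proof.
apply/setP => e; rewrite !inE; apply/negP => /iter_findex E.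
by have := depth_iter (findex (parent par) ord0 (child e)) ord0;
   rewrite E depth0 depth_child.
Qed.

Lemma root_path_child e : root_path par (child e) = e |: root_path par (par e).
Proof.
apply/setP => e'; rewrite !inE fconnect_eqVf parent_child.
by rewrite (inj_eq lift_inj) eq_sym.
Qed.

Lemma notin_root_path_par e : e \notin root_path par (par e).
Proof.
rewrite inE; apply/negP => /iter_findex E.
by have := depth_iter (findex (parent par) (par e) (child e)) (par e);
   rewrite E depth_child ltnn.
Qed.

Variable R : realType.
Local Open Scope ring_scope.

Lemma weight_root (f : 'I_m -> R) : weight f (root_path par ord0) = 0.
Proof. by rewrite /weight root_path0 big_set0. Qed.

Lemma weight_child (f : 'I_m -> R) e :
  weight f (root_path par (child e)) = f e + weight f (root_path par (par e)).
Proof. by rewrite /weight root_path_child big_setU1 // notin_root_path_par. Qed.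

(** * Weights compatible with a fixed threshold *)

Section Threshold.
Variables (t0 : 'I_m.+1) (lo hi : 'I_m -> R) (D : R).
Variables (H L d : nat -> R) (onp : nat -> nat).
Hypothesis onpP : forall v, (0 < onp v)%N <-> (0 < v)%N /\ exists j, v = iter j parents t0.
Hypotheses (H0 : H 0%N = 0) (L0 : L 0%N = 0) (d0 : d 0%N = 0).
Hypotheses (HS : forall e, H (child e) = H (par e) + hi e)
  (LS : forall e, L (child e) = L (par e) + lo e)
  (dS : forall e, d (child e) = if (0 < onp (child e))%N
     then Num.min (H (child e)) (L (child e) + (D - L t0))
     else d (par e) + (H (child e) - H (par e))).
Hypothesis lohi : forall e, lo e <= hi e.

Let wt e := d (child e) - d (par e).

Lemma weight_dist v : weight wt (root_path par v) = d v.
Proof.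
elim/node_ind: v => [|e IH]; first by rewrite weight_root.
by rewrite weight_child IH /wt subrK.
Qed.

(** The recurrence covers only the non-root nodes; at the root, [L t0 <= D] makes the minimum 0. *)
Lemma dist_on_path (v : 'I_m.+1) : L t0 <= D -> (exists j, v = iter j (parent par) t0) ->
  d v = Num.min (H v) (L v + (D - L t0)).
Proof.
move=> LD [j vj]; case: (unliftP ord0 v) vj => [e|] -> vj.
  rewrite -/(child e) dS ifT //; apply/onpP; split; first by rewrite lift0.
  by exists j; rewrite iter_parents -vj.
by rewrite /= H0 L0 d0 add0r min_l // subr_ge0.
Qed.

Lemma dist_feasible : L t0 <= D <= H t0 ->
  weight wt (root_path par t0) = D /\ forall e, lo e <= wt e <= hi e.
Proof.
move=> /andP[LD DH]; split.
  rewrite weight_dist dist_on_path //; last by exists 0%N.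
  (* At [t0] the second term equals [D], which is at most [H t0]. *)
  by rewrite addrC subrK min_r.
(* If the lower end of [e] is on the path, so is its parent, and both carry the minimum; otherwise
   the increment is [hi e]. *)
move=> e; rewrite /wt; have [/onpP [_ [j ej]]|noton] := boolP (0 < onp (child e))%N.
  have {}ej : child e = iter j (parent par) t0.
    by apply: val_inj; apply: etrans ej (iter_parents _ _).
  rewrite dist_on_path //; last by exists j.
  rewrite dist_on_path //; last by exists j.+1; rewrite /= -ej parent_child.
  have := lohi e; rewrite HS LS.
  case: (leP (H (par e)) (L (par e) + (D - L t0))) => h1;
  case: (leP (H (par e) + hi e) (L (par e) + lo e + (D - L t0))) => h2; lra.
by rewrite dS (negPf noton) HS; have := lohi e; lra.
Qed.

Variable f : 'I_m -> R.
Hypotheses (fbox : forall e, lo e <= f e <= hi e)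
           (fD : weight f (root_path par t0) = D).

Lemma extreme_bounds (v : 'I_m.+1) : L v <= weight f (root_path par v) <= H v.
Proof.
elim/node_ind: v => [|e IH]; first by rewrite weight_root H0 L0 lexx.
by rewrite weight_child HS LS; have := fbox e; move: IH; lra.
Qed.

(** Along the path to [t0], the excess of the distance for [f] over [L] cannot decrease away from
    the root and ends at [D - L t0]; this gives the second bound in the minimum. Off the path an
    edge contributes at most [hi]. *)
Lemma weight_le_dist (v : 'I_m.+1) : weight f (root_path par v) <= d v.
Proof.
have slack j : weight f (root_path par (iter j (parent par) t0)) -
    L (iter j (parent par) t0) <= D - L t0.
  elim: j => [|j]; first by rewrite /= fD.
  rewrite /=; apply: le_trans.
  case: (unliftP ord0 (iter j (parent par) t0)) => [e|] ->; last by rewrite parent0.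
  by rewrite parent_child -/(child e) weight_child LS; have := fbox e; lra.
elim/node_ind: v => [|e IH]; first by rewrite weight_root d0.
rewrite dS; case: ifP => [/onpP[_ [j ej]]|_].
  have {}ej : child e = iter j (parent par) t0.
    by apply: val_inj; apply: etrans ej (iter_parents _ _).
  have := extreme_bounds (child e); rewrite le_min => /andP[_ ->] /=.
  by have := slack j; rewrite -ej; lra.
by rewrite weight_child HS; have := fbox e; move: IH; lra.
Qed.

End Threshold.
End Tree.

(** * Binary search over the thresholds *)

(* Integer registers 10 and 11 enclose the least threshold that passes the test. *)
Definition search_step : cmd :=
  Seq (ISet 12 (IHalf (IAdd (IReg 10) (IReg 11))))
  (Seq (RSet 1 (RGet 3 (IGet 3 (IReg 12))))
  (Seq test
       (If (ILe (ICst 1) (IReg 9)) (ISet 11 (IReg 12))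
           (ISet 10 (IAdd (IReg 12) (ICst 1)))))).

(** The upper end [n], one past the last index, stands for the case that no threshold passes. *)
Definition search : cmd :=
  Seq (ISet 10 (ICst 0))
  (Seq (ISet 11 (IReg 0))
       (While (ILt (IReg 10) (IReg 11)) search_step)).

Definition write_solution : cmd :=
  For 2 (RPut 4 (IReg 2) (RSub (RGet 8 (IReg 2)) (RGet 8 (IGet 0 (IReg 2))))).

(** The test is repeated because the arrays may stem from another threshold, tried after the least
    one. Integer and real register 0 are overwritten last, as the loops and the test read [n] and
    [D] there. *)
Definition report : cmd :=
  If (ILe (IReg 0) (IReg 10)) (ISet 0 (ICst 0))
     (Seq (RSet 1 (RGet 3 (IGet 3 (IReg 10))))
     (Seq test
     (Seq write_solution
     (Seq (RSet 0 (RReg 1)) (ISet 0 (ICst 1)))))).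

(* The root plays the role of an edge of cost 0 in the second sort, which makes
   0 the first threshold. *)
Definition solver : cmd :=
  Seq depths
  (Seq (merge_sort 5 2)
  (Seq (merge_sort 3 3)
  (Seq mark_path
  (Seq mark_inner
  (Seq search report))))).

(** * Correctness of the test, the search and the report *)

Section Instance.
Variables (R : realType) (m : nat) (par : 'I_m -> 'I_m.+1) (t0 : 'I_m.+1).
Variables (l w u c : 'I_m -> R) (D : R).
Hypotheses (rooted : rooted_tree par) (lwu : forall e, (l e <= w e <= u e)%R)
  (c0 : forall e, (0 < c e)%R).
Implicit Types s : state R.

Let n := m.+1.
Let P := parents par.
Let dpt v := depth rooted (inord v).

Lemma depth_nat0 : dpt 0 = 0.
Proof.
rewrite /dpt; have -> : inord 0 = ord0 :> 'I_m.+1 by apply: val_inj; rewrite /= inordK.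
exact: depth0.
Qed.

Lemma depth_natS v : 0 < v < n -> dpt v = (dpt (P v)).+1.
Proof.
move=> /childP[e ->]; rewrite /P parents_child /dpt.
by rewrite !inord_val depth_child.
Qed.

Lemma depth_nat_lt v : v < n -> dpt v < n.
Proof. by move=> _; apply: depth_lt. Qed.

Definition allowed (C : R) (f : 'I_m -> R) : Prop :=
  feasible par t0 l u D f /\ forall e, f e != w e -> (c e <= C)%R.

Lemma objective_leP (C : R) (f : 'I_m -> R) : (0 <= C)%R ->
  (objective c w f <= C)%R <-> forall e, f e != w e -> (c e <= C)%R.
Proof.
move=> C0; rewrite /objective /hamming; split.
  move=> /bigmax_leP[_ h] e ne; have := h e isT.
  by rewrite ne mulr1.
move=> h; apply/bigmax_leP; split=> // e _; case: ifP => [/h|_].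
  by rewrite mulr1.
by rewrite mulr0.
Qed.

(** Cell 0 of the cost array holds 0, the value when no edge changes, so the cells sorted by cost
    contain every possible objective value. *)
Lemma objective_attained (f : 'I_m -> R) :
  exists2 v, v < n & objective c w f = edge_array 0%R c v.
Proof.
rewrite /objective; elim/big_ind: _.
- by exists 0.
- move=> x y [v vn ->] [v' vn' ->]; case: leP => _; [by exists v'|by exists v].
- move=> e _; rewrite /hamming; case: ifP => _.
    by exists (child e); rewrite ?edge_array_child ?mulr1.
  by exists 0; rewrite ?mulr0.
Qed.

Lemma edge_cost_ge0 v : (0 <= edge_array 0%R c v)%R.
Proof.
case: v => //= v; case: insubP => //= e _ _; exact: ltW.
Qed.

(** Holds from the end of the preprocessing until the report and is preserved by each test, which
    never writes the root cells of arrays 6 to 8. *)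
Record prepared (by_depth by_cost : nat -> nat) (s : state R) : Prop := Prepared {
  prep_n : ireg s 0 = n;
  prep_t0 : ireg s 1 = t0;
  prep_D : rreg s 0 = D;
  prep_par : iarr s 0 = P;
  prep_by_depth : iarr s 2 = by_depth;
  prep_by_cost : iarr s 3 = by_cost;
  prep_l : rarr s 0 = edge_array 0%R l;
  prep_w : rarr s 1 = edge_array 0%R w;
  prep_u : rarr s 2 = edge_array 0%R u;
  prep_c : rarr s 3 = edge_array 0%R c;
  prep_path : forall v, 0 < iarr s 5 v <-> 0 < v /\ exists j, v = iter j P t0;
  prep_inner : forall v, 0 < iarr s 6 v <-> exists2 x, 0 < x < n & P x = v;
  prep_0 : [/\ rarr s 6 0 = 0%R, rarr s 7 0 = 0%R & rarr s 8 0 = 0%R] }.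

Variables by_depth by_cost : nat -> nat.
Hypotheses (Olt : forall x, x < n -> by_depth x < n)
  (Osort : forall x y, x <= y -> y < n -> dpt (by_depth x) <= dpt (by_depth y))
  (Osurj : forall v, v < n -> exists2 x, x < n & by_depth x = v).

Definition solution s (e : 'I_m) : R := (rarr s 8 (child e) - rarr s 8 (par e))%R.

(** The Boolean hypothesis runs through the memory mentioned in [prepared], except real arrays 6 to
    8, which the test overwrites away from the root. *)
Lemma prepared_agree W s s' : prepared by_depth by_cost s -> agree W s s' ->
  all (fun x => x \notin W) [:: (0, 0); (0, 1); (1, 0); (2, 0); (2, 2); (2, 3);
    (3, 0); (3, 1); (3, 2); (3, 3); (2, 5); (2, 6)] ->
  [/\ rarr s' 6 0 = 0%R, rarr s' 7 0 = 0%R & rarr s' 8 0 = 0%R] ->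
  prepared by_depth by_cost s'.
Proof.
case=> p1 p2 p3 p4 p5 p6 p7 p8 p9 p10 p11 p12 _ [e0 e1 e2 e3] /= h z.
repeat (case/andP: h => ? h).
by split=> //; rewrite ?e0 ?e1 ?e2 ?e3.
Qed.

Lemma inner_leaf s (v : 'I_m.+1) : prepared by_depth by_cost s -> iarr s 6 v = 0 <-> leaf par v.
Proof.
move=> /prep_inner ps; have {}ps := ps v; split=> [v0 e ev|lv].
  have : 0 < iarr s 6 v.
    by apply/ps; exists (child e); [rewrite lift0 /= ltnS|rewrite /P parents_child ev].
  by rewrite v0.
apply/eqP; rewrite -leqn0 leqNgt; apply/negP => /ps[x /childP[e ->]].
by rewrite /P parents_child => /val_inj /lv.
Qed.

(** Soundness comes from [dist_feasible], completeness from [extreme_bounds] at [t0] and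
    [weight_le_dist] at the leaves. *)
Lemma test_correct s : prepared by_depth by_cost s ->
  runs test s (n * 200) (fun s' =>
    [/\ prepared by_depth by_cost s', 0 < ireg s' 9 -> allowed (rreg s 1) (solution s')
      & forall f, allowed (rreg s 1) f -> 0 < ireg s' 9]).
Proof.
move=> ps; have [z6 z7 z8] := prep_0 ps; set C := rreg s 1.
apply: (runs_weaken (test_runs (ltn0Sn m) depth_natS Olt Osort Osurj (prep_n ps)
  (prep_par ps) (prep_by_depth ps) (prep_t0 ps) (erefl _) z6 z7 z8)) => // s' ag [z0 rec ok].
have ps' := prepared_agree ps ag isT z0.
have [y6 y7 y8] := z0.
(* Edges costing more than [C] get the degenerate interval at [w e], so the box encodes both the
   bounds and the set of edges that may change. *)
pose lo e := (if c e <= C then l e else w e)%R.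
pose hi e := (if c e <= C then u e else w e)%R.
have recc e : [/\ rarr s' 6 (child e) = rarr s' 6 (par e) + hi e,
     rarr s' 7 (child e) = rarr s' 7 (par e) + lo e
   & rarr s' 8 (child e) = if (0 < iarr s 5 (child e))%N
              then Num.min (rarr s' 6 (child e)) (rarr s' 7 (child e) + (D - rarr s' 7 t0))
              else rarr s' 8 (par e) + (rarr s' 6 (child e) - rarr s' 6 (par e))]%R.
  have he : 0 < child e < n by rewrite lift0 /= ltnS.
  have := rec _ he; rewrite /upper /lower (prep_l ps) (prep_w ps) (prep_u ps) (prep_c ps).
  by rewrite !edge_array_child /P !parents_child (prep_D ps).
have HS e : rarr s' 6 (child e) = (rarr s' 6 (par e) + hi e)%R by have [] := recc e.
have LS e : rarr s' 7 (child e) = (rarr s' 7 (par e) + lo e)%R by have [] := recc e.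
have dS e : rarr s' 8 (child e) = (if (0 < iarr s 5 (child e))%N
              then Num.min (rarr s' 6 (child e)) (rarr s' 7 (child e) + (D - rarr s' 7 t0))
              else rarr s' 8 (par e) + (rarr s' 6 (child e) - rarr s' 6 (par e)))%R.
  by have [] := recc e.
have lohi e : (lo e <= hi e)%R.
  by rewrite /lo /hi; case: ifP => // _; have := lwu e; lra.
have sD := prep_D ps.
split=> //.
- case/ok; rewrite sD => bnd leaves.
  have [wD box] := dist_feasible rooted (prep_path ps) y6 y7 y8 HS LS dS lohi bnd.
  rewrite -/(solution s') in wD box; split; last first.
    move=> e; have := box e; rewrite /lo /hi; case: ifP => // _ h /negP[].
    by rewrite eq_le andbC; exact: h.
  split=> // [t lt|e].
    rewrite (weight_dist rooted) //; apply: leaves => //.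
    exact/(inner_leaf t ps).
  have := box e; have := lwu e; rewrite /lo /hi -/(solution s' e); case: ifP => _; lra.
- move=> f [[leaves fD fbox] fC].
  have box e : (lo e <= f e <= hi e)%R.
    rewrite /lo /hi; case: ifP => [_|/negP h]; first exact: fbox.
    have [->|/fC//] := eqVneq (f e) (w e).
    by rewrite lexx.
  apply/ok; rewrite sD; split.
    by rewrite -{1 2}fD; apply: (extreme_bounds rooted y6 y7 HS LS box).
  move=> v vn v6; pose v' : 'I_m.+1 := Ordinal vn.
  apply: (le_trans (leaves v' _)); first exact/(inner_leaf v' ps).
  exact: (weight_le_dist rooted (prep_path ps) y6 y7 y8 HS LS dS box fD v').
Qed.

Hypotheses (Ssort : forall x y, x <= y -> y < n ->
    (edge_array 0 c (by_cost x) <= edge_array 0 c (by_cost y))%R)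
  (Ssurj : forall v, v < n -> exists2 x, x < n & by_cost x = v).

Let thr j := edge_array 0%R c (by_cost j).

(** The value [k = n] stands for an infeasible instance. *)
Definition least_threshold (k : nat) : Prop :=
  [/\ k <= n, forall j f, j < k -> ~ allowed (thr j) f
    & k < n -> exists f, allowed (thr k) f].

Lemma search_runs s : prepared by_depth by_cost s ->
  runs search s (300 * (n * (trunc_log 2 n).+1)) (fun s' =>
    prepared by_depth by_cost s' /\ least_threshold (ireg s' 10)).
Proof.
move=> ps.
do 2! [apply: runs_seq_wpl; [rewrite /=; lia|rewrite [wpl _ _ _]/=]].
set s1 := set_ireg _ _ _.
(* The interval from register 10 to register 11 is shorter than [2 ^ k]; every index before it
   fails, and its upper end passes unless it is [n]. *)
pose I k s' := prepared by_depth by_cost s' /\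
  [/\ ireg s' 11 < ireg s' 10 + 2 ^ k, ireg s' 10 <= ireg s' 11 <= n,
     forall j f, j < ireg s' 10 -> ~ allowed (thr j) f
   & ireg s' 11 < n -> exists f, allowed (thr (ireg s' 11)) f].
have W := @runs_while R I (ILt (IReg 10) (IReg 11)) search_step (n * 200 + 30) s1
  (trunc_log 2 n).+1.
apply: (runs_weaken (W _ _)).
- move=> k s2 _ [ps2 [lt_k le fails ok]] /=; rewrite -ltnNge => lt.
  case: k lt_k => [|k] lt_k; first by lia.
  exists k => //.
  do 2! [apply: runs_seq_wpl; [by rewrite /=; lia|rewrite [wpl _ _ _]/=]].
  set mid := (_ + _)./2.
  have hmid : ireg s2 10 <= mid < ireg s2 11 by rewrite /mid; lia.
  set s3 := set_rreg _ _ _.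
  have ps3 : prepared by_depth by_cost s3 by case: ps2; split.
  have s31 : rreg s3 1 = thr mid.
    by rewrite /s3 /= (prep_c ps2) (prep_by_cost ps2).
  apply: (@runs_seq _ (n * 200)); first by rewrite /=; lia.
  apply: (runs_weaken (test_correct ps3)) => // s4 [e0 _ _ _].
  rewrite s31 => -[ps4 sound complete].
  apply: runs_loopfree; first by rewrite /=; lia.
  have s40 : ireg s4 10 = ireg s2 10 by rewrite e0.
  have s41 : ireg s4 11 = ireg s2 11 by rewrite e0.
  have s42 : ireg s4 12 = mid by rewrite e0.
  rewrite /= /I /= s40 s41 s42; split=> pass; (split; first by case: ps4; split).
    split=> //; [by move: lt_k; rewrite expnS /mid; lia|by lia|].
    by move=> _; exists (solution s4); apply: sound.
  split=> //; [by move: lt_k; rewrite expnS /mid; lia|by lia|].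
  (* A solution allowed at a smaller threshold is allowed at [mid], so failure at [mid] extends to
     all indices below it. *)
  move=> j f jm [ff fj]; move/negP: pass; apply; apply: (complete f); split=> // e /fj h.
  by apply: le_trans h (Ssort _ _); lia.
- split; first by case: ps; split.
  rewrite /= (prep_n ps); split=> //; last by lia.
  exact: trunc_log_ltn.
- have : trunc_log 2 n <= n * trunc_log 2 n by rewrite leq_pmull.
  by rewrite /=; lia.
- move=> s2 _ [h [k [ps2 [lt_k le fails ok]]]]; split=> //.
  have E : ireg s2 11 = ireg s2 10 by move: h; rewrite /= negbK; lia.
  by split=> //; [lia|rewrite -E].
Qed.

(** Every feasible [g] has objective value [thr j] for some [j], and [j < k] would contradict the
    failure of the thresholds before [k]. Applied to [f] itself, this bound gives the equality. *)
Lemma threshold_optimal k f : least_threshold k -> k < n -> allowed (thr k) f ->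
  optimal par t0 l w u c D f /\ thr k = objective c w f.
Proof.
move=> [_ fails _] kn [ff fk].
have C0 : (0 <= thr k)%R by apply: edge_cost_ge0.
have fle : (objective c w f <= thr k)%R by apply/objective_leP.
have lower g : feasible par t0 l u D g -> (thr k <= objective c w g)%R.
  move=> fg; have [v vn E] := objective_attained g.
  have [j jn Sj] := Ssurj vn.
  have [jk|kj] := ltnP j k; last by rewrite E -Sj; apply: Ssort.
  case: (fails j g jk); split=> //; apply/objective_leP; first exact: edge_cost_ge0.
  by rewrite /thr Sj E.
split; last by apply: le_anti; rewrite fle lower.
by split=> // g fg; apply: le_trans fle (lower _ fg).
Qed.

Lemma report_runs s : prepared by_depth by_cost s -> least_threshold (ireg s 10) ->
  runs report s (n * 300) (correct_output par t0 l w u c D).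
Proof.
move=> ps lk; have [kn fails ok] := lk.
set k := ireg s 10 in lk kn fails ok.
have [nk|kn'] := leqP n k.
  have ex := @ExIfT R s _ (ILe (IReg 0) (IReg 10)) (ISet 0 (ICst 0)) _ _ _ (ExISet _ _ _).
  eexists _, _; split; first by apply: ex; rewrite /= (prep_n ps).
    by rewrite /=; lia.
  (* A feasible [f] would be allowed at its own objective value, which is a threshold of index below
     [n]. *)
  left; split=> // -[f ff]; have [v vn E] := objective_attained f.
  have [j jn Sj] := Ssurj vn.
  case: (fails j f); first by lia.
  split=> //; apply/objective_leP; first exact: edge_cost_ge0.
  by rewrite /thr Sj E.
suff [t [s' [ex tB cs]]] : runs (Seq (RSet 1 (RGet 3 (IGet 3 (IReg 10))))
     (Seq test (Seq write_solution (Seq (RSet 0 (RReg 1)) (ISet 0 (ICst 1))))))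
     s (n * 290) (correct_output par t0 l w u c D).
  exists (bcost (ILe (IReg 0) (IReg 10)) + t).+1, s'; split=> //; last by rewrite /=; lia.
  by apply: ExIfF ex; rewrite /= (prep_n ps) -ltnNge.
apply: runs_seq_wpl; [by rewrite /=; lia|rewrite [wpl _ _ _]/=].
set s1 := set_rreg _ _ _.
have ps1 : prepared by_depth by_cost s1 by case: ps; split.
have s11 : rreg s1 1 = thr k by rewrite /s1 /= (prep_c ps) (prep_by_cost ps).
apply: (@runs_seq _ (n * 200)); first by rewrite /=; lia.
apply: (runs_weaken (test_correct ps1)) => // s2 [_ e1 _ _].
rewrite s11 => -[ps2 sound complete].
have {ok} [f fk] := ok kn'.
have {sound} := sound (complete f fk); move=> {complete f fk} al.
have [opt obj] := threshold_optimal lk kn' al.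
apply: (@runs_seq _ (n * 28)); first by rewrite /=; lia.
apply: (runs_weaken (runs_for (B := 12) (I := fun i s' => forall x, x < i ->
  rarr s' 4 x = (rarr s2 8 x - rarr s2 8 (P x))%R) (prep_n ps2) _ _ _ _ _ _)) => //.
  move=> i s3 lt_in [_ _ f2 f3] s32 Ii; apply: runs_loopfree => //= x hx.
  rewrite s32 f2 // !(f3 8) // (prep_par ps2); case: eqVneq => [->//|nx].
  by apply: Ii; lia.
move=> s3 [_ f1 _ _] sol; apply: runs_loopfree => /=; first by lia.
have E : (fun e : 'I_m => rarr s3 4 (child e)) = solution s2.
  by apply: funext => e; rewrite sol // /P parents_child.
by right; split=> //=; rewrite E // f1 // e1 // s11.
Qed.

End Instance.

(** With [n = m + 1], the seven stages cost at most 100, 200, 200, 20, 30, 300 and 300 times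
    [n * (trunc_log 2 n).+1], which leaves room below 1500. *)
Lemma solver_runs (R : realType) m (par : 'I_m -> 'I_m.+1) (t0 : 'I_m.+1)
    (l w u c : 'I_m -> R) (D : R) :
  rooted_tree par -> (forall e, (l e <= w e <= u e)%R) -> (forall e, (0 < c e)%R) ->
  runs solver (input par t0 l w u c D) (1500 * (m.+1 * (trunc_log 2 m.+1).+1))
    (correct_output par t0 l w u c D).
Proof.
move=> rooted lwu c0; set s := input _ _ _ _ _ _ _.
set n := m.+1; set L := (trunc_log 2 n).+1.
have nL : n <= n * L by rewrite leq_pmulr.
have n0 : 0 < n by [].
have P0 : parents par 0 = 0 by [].
pose dpt v := depth rooted (inord v).
apply: (@runs_seq _ (100 * (n * L))); first by lia.
apply: (runs_weaken (@depths_runs R n (parents par) dpt n0 P0 (@parents_lt _ par)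
  (depth_nat0 rooted) (@depth_natS _ _ rooted) (@depth_nat_lt _ _ rooted) s _ _)) => //.
move=> s1 [a0 a1 a2 a3] s1d.
apply: (@runs_seq _ (200 * (n * L))); first by lia.
apply: (runs_weaken (@merge_sort_runs R n 5 2 n0 _ s1 _)) => //; first by rewrite a0.
move=> s2 [b0 b1 b2 b3] [Osort Olt Osurj].
apply: (@runs_seq _ (200 * (n * L))); first by lia.
apply: (runs_weaken (@merge_sort_runs R n 3 3 n0 _ s2 _)) => //; first by rewrite b0 ?a0.
move=> s3 [d0 d1 d2 d3] [Ssort _ Ssurj].
apply: (@runs_seq _ (n * 20)); first by lia.
have [s30 s31 s3P s35 s36] : [/\ ireg s3 0 = n, ireg s3 1 = t0, iarr s3 0 = parents par,
    forall v, iarr s3 5 v = 0 & forall v, iarr s3 6 v = 0].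
  by split=> [| | |v|v]; rewrite ?d0 ?d2 ?b0 ?b2 ?a0 ?a2.
apply: (runs_weaken (@mark_path_runs R n (parents par) dpt n0 P0 (@parents_lt _ par)
  (depth_nat0 rooted) (@depth_natS _ _ rooted) (@depth_nat_lt _ _ rooted)
  t0 s3 (ltn_ord t0) s31 s3P s35)) => // s4 [f0 f1 f2 f3] path.
apply: (@runs_seq _ (n * 30)); first by lia.
have s40 : ireg s4 0 = n by rewrite f0.
have s4P : iarr s4 0 = parents par by rewrite f2.
have s46 v : iarr s4 6 v = 0 by rewrite f2.
apply: (runs_weaken (@mark_inner_runs R n (parents par) n0 s4 s40 s4P s46)) => // s5 [g0 g1 g2 g3] inner.
have {}Olt x : x < n -> iarr s2 2 x < n := Olt x.
have {}Osort x y : x <= y -> y < n -> dpt (iarr s2 2 x) <= dpt (iarr s2 2 y).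
  move=> xy yn; have := Osort x y xy yn; rewrite !s1d ?ler_nat //; apply: Olt => //.
  exact: leq_ltn_trans xy yn.
have s2c : rarr s2 3 = edge_array 0%R c by rewrite b3 // a3.
rewrite s2c in Ssort.
have ps : prepared par t0 l w u c D (iarr s2 2) (iarr s3 3) s5.
  by split=> //; rewrite ?g0 ?g1 ?g2 ?g3 // ?f0 ?f1 ?f2 ?f3 // ?d0 ?d1 ?d2 ?d3 //
    ?b0 ?b1 ?b2 ?b3 // ?a0 ?a1 ?a2 ?a3.
apply: (@runs_seq _ (300 * (n * L))); first by lia.
apply: (runs_weaken (search_runs lwu Olt Osort Osurj Ssort ps)) => // s6 _ [ps6 least].
apply: (runs_weaken (report_runs lwu c0 Olt Osort Osurj Ssort Ssurj ps6 least)) => //.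
by lia.
Qed.

Local Open Scope ring_scope.

Theorem theorem3 (R : realType) :
  exists (p : cmd) (T : nat -> nat),
    O_nlogn T /\
    forall (m : nat) (par : 'I_m -> 'I_m.+1) (t0 : 'I_m.+1)
           (l w u c : 'I_m -> R) (D : R),
      rooted_tree par ->
      leaf par t0 ->
      (forall e, l e <= w e <= u e) ->
      (forall e, 0 < c e) ->
      exists (t : nat) (s : state R),
        [/\ exec p (input par t0 l w u c D) t s,
            (t <= T m.+1)%N
          & correct_output par t0 l w u c D s].
Proof.
exists solver, (fun n => 1500 * (n * (trunc_log 2 n).+1))%N; split.
  (* For [n >= 2] the logarithm is at least 1, so adding 1 at most doubles it. *)
  exists 3000, 2 => n n2; have : (0 < trunc_log 2 n)%N by apply: trunc_log_max.
  by move: (trunc_log 2 n) => k; nia.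
by move=> m par t0 l w u c D rooted _ lwu c0; apply: solver_runs.
Qed.
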